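(* For every $\alpha\in KC$, the Fourier-Wiener series $$W_\alpha(t)=X_0(\alpha)\,t+\sqrt{2}\sum_{n=1}^{\infty}\frac{1}{2\pi n}\Big(X_n(\alpha)\sin 2\pi nt+Y_n(\alpha)(1-\cos 2\pi nt)\Big),\qquad t\in[0,1],$$ whose coefficients are $X_n(\alpha)=\xi_{2n}(\alpha)$ and $Y_n(\alpha)=\xi_{2n+1}(\alpha)$, converges to a continuous function.
   Context: Write $\omega$ for the non-negative integers and $\mathcal{N}=\{-1,1\}^{\omega}$ for the space of infinite sequences $\alpha=\alpha_0\alpha_1\dots$ of $\pm1$. Let $\overline{\alpha}(n)$ be the initial segment of $\alpha$ of length $n$. $K$ denotes (prefix-free, i.e. self-delimiting) Kolmogorov complexity of finite strings. A sequence $\alpha\in\mathcal{N}$ is Kolmogorov-Chaitin complex if there is $k$ such that $K(\overline{\alpha}(n))\ge n-k$ for all $n$; the set of such $\alpha$ is denoted $KC$. The variables $\xi_n$ are defined as follows. Let $g$ be the function defined on $(0,1)$ by $$a=\frac{1}{\sqrt{2\pi}}\int_{-\infty}^{g(a)}e^{-t^2/2}\,dt,\qquad a\in(0,1),$$ i.e. $g$ is the inverse of the standard normal distribution function. Fix a computable bijection $\varphi:\omega^2\to\omega$. Associate to $\alpha\in\mathcal{N}$ the sequence $(\beta_n)_{n\in\omega}$ with $\beta_k=\alpha_{\varphi(k,0)}\alpha_{\varphi(k,1)}\alpha_{\varphi(k,2)}\dots\in\mathcal{N}$. Each $\beta_k$ is identified with the real number in $[0,1]$ having it as binary expansion (the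 symbol $-1$ read as the digit $0$). Set $\xi_n(\alpha)=g(\beta_n)$. (With respect to the uniform product probability measure on $\mathcal{N}$, $(\xi_n)$ is a sequence of independent standard normal random variables.) *)

(* Defs.v *)
From HB Require Import structures.
From mathcomp Require Import all_boot all_order all_algebra.
From mathcomp Require Import all_classical all_reals all_analysis.

Set Implicit Arguments.
Unset Strict Implicit.
Unset Printing Implicit Defensive.
Import Order.TTheory GRing.Theory Num.Theory.
Import numFieldNormedType.Exports.
Local Open Scope classical_set_scope.
Local Open Scope nat_scope.

(* A partial function nat^n -> nat, given by its graph. *)
Definition pfun (n : nat) := n.-tuple nat -> nat -> Prop.

(* Kleene's class of partial recursive functions. *)
Inductive partrec : forall n, pfun n -> Prop :=
| partrec_zero n :
    @partrec n (fun _ y => y = 0)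
| partrec_succ :
    @partrec 1 (fun v y => y = (thead v).+1)
| partrec_proj n (i : 'I_n) :
    @partrec n (fun v y => y = tnth v i)
| partrec_comp m n (f : pfun m) (g : 'I_m -> pfun n) :
    partrec f -> (forall i, partrec (g i)) ->
    @partrec n (fun v y =>
      exists w : m.-tuple nat, (forall i, g i v (tnth w i)) /\ f w y)
  (* h(0, v) = f(v) and h(k+1, v) = g(k, h(k, v), v); s lists the values of
     h(-, v) *)
| partrec_prec n (f : pfun n) (g : pfun n.+2) :
    partrec f -> partrec g ->
    @partrec n.+1 (fun v y =>
      let v' : n.-tuple nat := [tuple of behead v] in
      exists s : nat -> nat,
        [/\ f v' (s 0),
            forall k, k < thead v -> g [tuple of k :: s k :: v'] (s k.+1)
          & y = s (thead v)])
  (* the least y with f(y, v) = 0, all f(z, v) with z < y being defined *)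
| partrec_mu n (f : pfun n.+1) :
    partrec f ->
    @partrec n (fun v y =>
      f [tuple of y :: v] 0 /\
      forall z, z < y -> exists u, f [tuple of z :: v] u.+1).

Definition computable2 (phi : nat -> nat -> nat) : Prop :=
  partrec (fun (v : 2.-tuple nat) y => y = phi (tnth v ord0) (tnth v ord_max)).

(* Throughout, the symbol 1 is encoded by true and the symbol -1 by false. *)
Definition string := seq bool.

(* Bijective base-2 numeration, least significant symbol first, with digits
   1 and 2 for false and true: a computable bijection from strings onto nat. *)
Fixpoint code (s : string) : nat :=
  if s is b :: s' then (code s').*2 + b.+1 else 0.

Lemma code_bij : bijective code.
Proof.
pose dec := fix dec fuel n : string :=
  if fuel is f.+1 then
    if n is m.+1 then odd m :: dec f m./2 else [::]
  else [::].
have decS f m : dec f.+1 m.+1 = odd m :: dec f m./2 by [].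
exists (fun n => dec n n).
- have H s : forall f, code s <= f -> dec f (code s) = s.
    elim: s => [|b s IH] [|f] //=; first by rewrite addnS.
    rewrite addnS ltnS => le_f.
    have -> : odd ((code s).*2 + b) = b by rewrite oddD odd_double oddb.
    have E : ((code s).*2 + b)./2 = code s by rewrite addnC half_bit_double.
    rewrite E IH //; apply: leq_trans le_f.
    by rewrite -addnn -addnA leq_addr.
  by move=> s; apply: H.
- have H f : forall n, n <= f -> code (dec f n) = n.
    elim: f => [|f IH] [|m] //; rewrite ltnS => le_f.
    rewrite decS /= IH; last by apply: leq_trans le_f; rewrite -{2}(odd_double_half m) -addnn addnA addnC leq_addr.
    by rewrite addnS addnC odd_double_half.
  by move=> n; apply: H.
Qed.

(* A partial function from strings to strings, given by its graph. *)
Definition machine := string -> string -> Prop.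

Definition computable_machine (M : machine) : Prop :=
  exists2 f : pfun 1, partrec f &
    forall p x, M p x <-> f [tuple code p] (code x).

Definition prefix_free (M : machine) : Prop :=
  forall p q x y, M p x -> M q y -> prefix p q -> p = q.

Definition prefix_machine (M : machine) : Prop :=
  computable_machine M /\ prefix_free M.

Definition universal (U : machine) : Prop :=
  prefix_machine U /\
  forall M, prefix_machine M ->
    exists c, forall p x, M p x ->
      exists2 q, U q x & size q <= size p + c.

(* The length of a shortest U-program for x. The default value 0, for x without
   a program, does not occur when U is universal, see universal_program. *)
Definition K (U : machine) (x : string) : nat :=
  if pselect (exists n, `[< exists2 p, U p x & size p = n >]) is left ex
  then ex_minn ex else 0.

Lemma universal_program (U : machine) (x : string) :
  universal U -> exists p, U p x.
Proof.
case=> _ univU.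
have only0 c : @partrec 1 (fun v y => thead v = 0 /\ y = c).
  elim: c => [|c IH].
    have := partrec_mu (partrec_proj (@Ordinal 2 1 isT)).
    congr partrec; apply/funext => v; apply/funext => y; apply/propext.
    rewrite /thead; case: v => -[|a []] //= sz; split.
    - rewrite !(tnth_nth 0) /= => -[<-]; case: y => [//|y] /(_ 0 isT)[u].
      by rewrite (tnth_nth 0).
    - by rewrite !(tnth_nth 0) /= => -[-> ->]; split.
  have := partrec_comp partrec_succ (fun _ : 'I_1 => IH).
  congr partrec; apply/funext => v; apply/funext => y; apply/propext; split.
  - by move=> [w [/(_ ord0)[v0 w0] ->]]; rewrite /thead w0.
  - move=> [v0 ->]; exists [tuple c]; split=> // i.
    by rewrite (tnth_nth 0) ord1.
have [|c] := univU (fun p y => p = [::] /\ y = x).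
  split; last by move=> p q ? ? [-> _] [-> _].
  exists (fun v y => thead v = 0 /\ y = code x) => // p y.
  rewrite /thead (tnth_nth 0) /=; split=> [[-> ->] //|[p0 /(bij_inj code_bij)]].
  by move=> ->; split=> //; apply: (bij_inj code_bij).
by move=> /(_ [::] x (conj erefl erefl))[q Uq _]; exists q.
Qed.

Definition KC (U : machine) : set (nat -> bool) :=
  [set alpha | exists k, forall n, n <= K U (mkseq alpha n) + k].

Local Open Scope ring_scope.

Section FourierWiener.
Variable R : realType.

Definition normal_cdf (x : R) : R :=
  (Num.sqrt (2 * pi))^-1 *
  \int[lebesgue_measure]_(t in `]-oo, x]) expR (- (t ^+ 2) / 2).

(* Only meaningful on ]0, 1[. *)
Definition g (a : R) : R := get [set x | normal_cdf x = a].

Definition binary_real (b : nat -> bool) : R :=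
  limn (series (fun i => (b i)%:R / 2 ^+ i.+1 : R)).

Definition beta (phi : nat -> nat -> nat) (alpha : nat -> bool) (k : nat)
  : nat -> bool := fun i => alpha (phi k i).

Definition xi phi alpha (n : nat) : R := g (binary_real (beta phi alpha n)).

Definition X phi alpha (n : nat) : R := xi phi alpha n.*2.
Definition Y phi alpha (n : nat) : R := xi phi alpha n.*2.+1.

Definition fourier_wiener phi alpha (N : nat) (t : R) : R :=
  X phi alpha 0 * t +
  Num.sqrt 2 * \sum_(1 <= n < N.+1)
    (2 * pi * n%:R)^-1 *
    (X phi alpha n * sin (2 * pi * n%:R * t) +
     Y phi alpha n * (1 - cos (2 * pi * n%:R * t))).

End FourierWiener.

(* Main.v *)
Require Import Defs.
From mathcomp Require Import all_boot all_order all_algebra.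
From mathcomp Require Import all_classical all_reals all_analysis.
From mathcomp Require Import measurable_realfun.
From mathcomp Require Import zify ring lra.
Import Order.TTheory GRing.Theory Num.Theory.
Import numFieldNormedType.Exports.

Set Implicit Arguments.
Unset Strict Implicit.
Unset Printing Implicit Defensive.

(** The set of alpha for which the series misbehaves has measure zero, and the
    point is to cover it by tests simple enough to be run by a machine.

    A sequence in KC passes every test: if the q-th of a computable sequence of
    sets contains only strings of length m_q, and at most 2 ^ (m_q - 2 q) of
    them, then an element of it is described by q in unary followed by an index
    of m_q - 2 q bits, and this has length m_q - q + O(1). So a prefix of alpha
    lies in only finitely many of these sets ([KC_test]).

    The tests used here involve the digits of the numbers beta_n, and neither
    the function g nor sines. For a nonempty set S of indices below 2 q, let w_n
    be the product of the digits of beta_n with index in S, read as signs. For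
    d > 0 the products w_n w_(n + d) are fair bets, each one new with respect
    to the preceding ones; hence their partial sums up to N = 2 ^ (18 (q + 1))
    exceed 2 ^ (10 q), somewhat more than the square root of N, with a
    probability that is doubly exponentially small in q, and this is the first
    test. The second one asks that, for n < N, the first 20 q + 20 digits of
    beta_n be not all equal. Together they give [KC_regular].

    The rest is deterministic. The square of the modulus of sum_(n < M) w_n
    exp(i n t) is M plus a combination, with coefficients bounded by 2, of the
    autocorrelations sum_n w_n w_(n + d) ([trig_energy]), so that a bound on the
    latter controls the former for all t at once, with no discretization of t:
    one gets O(2 ^ (14 q)) for 2 ^ (18 q) <= M < 2 ^ (18 (q + 1)), a power less
    than M. By Fourier inversion on bit strings the indicator function of each
    word of 2 q digits is, up to its mean, an average of Walsh functions, so it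
    obeys the same bound ([word_discrepancy]). Finally g(beta_n) is replaced by
    a function of the first 2 q digits of beta_n. The function can be chosen
    with mean zero because g(1 - a) = - g(a), and the replacement is harmless
    because g is monotone and grows at most like a logarithm at the ends. This
    gives |sum_(n < M) g(beta_n) cos(n t)| <= C M 2 ^ - q and the same for sines
    ([KC_trig_sum]). Summation by parts turns this into a Cauchy criterion,
    uniform in t, for the series with the weights 1 / n ([dyadic_abel]), and a
    uniform limit of continuous functions is continuous. *)

Local Notation code := Defs.code.
Local Open Scope nat_scope.

(** * Total recursive functions *)

(** Arguments are passed as a sequence, the most recently bound variable first,
    so that a function under a binder is again of this form, with one argument
    more; f matters only on sequences of length n. *)
Definition rc n (f : seq nat -> nat) : Prop :=
  @partrec n (fun v y => y = f v).

Lemma partrec_ext n (f g : pfun n) :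
  (forall v y, f v y <-> g v y) -> partrec f -> partrec g.
Proof.
move=> fg; suff -> : f = g by [].
by apply/funext => v; apply/funext => y; apply/propext.
Qed.

Lemma rc_ext n (f g : seq nat -> nat) : (forall v : n.-tuple nat, f v = g v) -> rc n f -> rc n g.
Proof. by move=> fg; apply: partrec_ext => v y; rewrite fg. Qed.

Lemma rc_nth n i : i < n -> rc n (fun e => nth 0 e i).
Proof.
move=> lt_in; apply: partrec_ext (partrec_proj (Ordinal lt_in)) => v y.
by rewrite (tnth_nth 0).
Qed.

Lemma rc_head n : rc n.+1 (fun e => head 0 e).
Proof. by apply: rc_ext (@rc_nth n.+1 0 isT) => v; rewrite nth0. Qed.

Lemma rc_comp m n f (g : 'I_m -> seq nat -> nat) :
  rc m f -> (forall i, rc n (g i)) ->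
  rc n (fun e => f [seq g i e | i <- enum 'I_m]).
Proof.
move=> Hf Hg; apply: partrec_ext (partrec_comp Hf Hg) => v y; split.
- case=> w [gw ->]; congr f; apply: (@eq_from_nth _ 0).
    by rewrite size_tuple size_map size_enum_ord.
  move=> i; rewrite size_tuple => lt_im.
  rewrite (nth_map (Ordinal lt_im)) ?size_enum_ord //.
  have := gw (Ordinal lt_im); rewrite (tnth_nth 0) /= => ->.
  by congr g; apply: val_inj; rewrite /= nth_enum_ord.
- move=> ->; exists [tuple g i v | i < m]; split=> [i|]; first by rewrite tnth_mktuple.
  by [].
Qed.

Lemma rc_behead n f : rc n f -> rc n.+1 (fun e => f (behead e)).
Proof.
move=> Hf.
have Hi (i : 'I_n) : rc n.+1 (fun e => nth 0 e i.+1) by apply: rc_nth; rewrite ltnS.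
apply: rc_ext (rc_comp Hf Hi) => v; congr f; apply: (@eq_from_nth _ 0).
  by rewrite size_map size_enum_ord size_behead size_tuple.
move=> i; rewrite size_map size_enum_ord => lt_in.
by rewrite (nth_map (Ordinal lt_in)) ?size_enum_ord // nth_enum_ord // nth_behead.
Qed.

Lemma rc_var k n : k < n -> rc n (fun e => head 0 (iter k behead e)).
Proof.
elim: k n => [|k IH] [|n] // lt_kn; first exact: rc_head.
apply: rc_ext (rc_behead (IH n lt_kn)) => v /=.
by rewrite -iterSr.
Qed.

Ltac rc_var := first
  [ by apply: (@rc_var 0) | by apply: (@rc_var 1)
  | by apply: (@rc_var 2) | by apply: (@rc_var 3)
  | by apply: (@rc_var 4) | by apply: (@rc_var 5)
  | by apply: (@rc_var 6) | by apply: (@rc_var 7) ].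

Definition rc1 (f : nat -> nat) := rc 1 (fun e => f (head 0 e)).
Definition rc2 (f : nat -> nat -> nat) :=
  rc 2 (fun e => f (head 0 e) (head 0 (behead e))).

Lemma rc_cons n f a : rc n.+1 f -> rc n a -> rc n (fun e => f (a e :: e)).
Proof.
move=> Hf Ha.
pose G (i : 'I_n.+1) (e : seq nat) := if i == 0 :> nat then a e else nth 0 e i.-1.
have HG i : rc n (G i).
  by rewrite /G; case: i => -[|i] lt_in //=; apply: rc_nth.
apply: rc_ext (rc_comp Hf HG) => v; congr f; apply: (@eq_from_nth _ 0).
  by rewrite size_map size_enum_ord /= size_tuple.
move=> i; rewrite size_map size_enum_ord => lt_in.
rewrite (nth_map (Ordinal lt_in)) ?size_enum_ord // /G nth_enum_ord //.
by case: i lt_in.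
Qed.

Lemma rc_app1 n f a : rc1 f -> rc n a -> rc n (fun e => f (a e)).
Proof.
move=> Hf Ha; apply: rc_ext (@rc_comp 1 n _ (fun=> a) Hf (fun=> Ha)) => v.
by rewrite (enum_ordSl 0).
Qed.

Lemma rc_app2 n f a b :
  rc2 f -> rc n a -> rc n b -> rc n (fun e => f (a e) (b e)).
Proof.
move=> Hf Ha Hb.
pose G (i : 'I_2) := if i == 0 :> nat then a else b.
have HG i : rc n (G i) by rewrite /G; case: ifP.
apply: rc_ext (rc_comp Hf HG) => v.
by rewrite !enum_ordSl.
Qed.

(** The premise on s is a pattern in the sense of Miller, so that it is found by
    unification when the lemma is applied; the same holds for [rc_sum] and
    [rc_ex]. *)
Lemma rc_rec n (k z : seq nat -> nat) (s : seq nat -> nat -> nat -> nat) :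
  rc n k -> rc n z ->
  rc n.+2 (fun e => s (behead (behead e)) (head 0 e) (head 0 (behead e))) ->
  rc n (fun e => nat_rect (fun=> nat) (z e) (s e) (k e)).
Proof.
move=> Hk Hz Hs.
have H : rc n.+1 (fun e => nat_rect (fun=> nat) (z (behead e)) (s (behead e)) (head 0 e)).
  apply: partrec_ext (partrec_prec Hz Hs) => v y.
  have -> : head 0 v = thead v by rewrite /thead (tnth_nth 0) nth0.
  split=> [[t [t0 tS ->]]|->].
    elim: (thead v) tS => [_|m IH tS] //=.
    rewrite -IH => [|j lt_jm]; last by apply: tS; apply: ltnW.
    by rewrite (tS m).
  exists (fun j => nat_rect (fun=> nat) (z (behead v)) (s (behead v)) j).
  by split.
by apply: rc_ext (rc_cons H Hk) => v.
Qed.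

Lemma rc_S n f : rc n f -> rc n (fun e => (f e).+1).
Proof.
suff S1 : rc1 S by apply: rc_app1 S1.
apply: partrec_ext partrec_succ => v y.
by rewrite /thead (tnth_nth 0) nth0.
Qed.

Lemma rc_const n c : rc n (fun=> c).
Proof. by elim: c => [|c IH]; [exact: partrec_zero | exact: rc_S]. Qed.

Lemma rc_add n f g : rc n f -> rc n g -> rc n (fun e => f e + g e).
Proof.
move=> Hf Hg.
have H := rc_rec (s := fun _ _ r => r.+1) Hg Hf.
apply: rc_ext (H _) => [v|].
  by elim: (g v) => [|m IH] /=; rewrite ?addn0 // IH addnS.
by apply: rc_S; rc_var.
Qed.

Lemma rc_pred n f : rc n f -> rc n (fun e => (f e).-1).
Proof.
move=> Hf.
apply: rc_ext (rc_rec (s := fun _ i _ => i) Hf (rc_const n 0) _) => [v|].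
  by case: (f v).
rc_var.
Qed.

Lemma rc_sub n f g : rc n f -> rc n g -> rc n (fun e => f e - g e).
Proof.
move=> Hf Hg.
have H := rc_rec (s := fun _ _ r => r.-1) Hg Hf.
apply: rc_ext (H _) => [v|].
  by elim: (g v) => [|m IH] /=; rewrite ?subn0 // IH subnS.
by apply: rc_pred; rc_var.
Qed.

Lemma rc_sum n k (F : seq nat -> nat -> nat) :
  rc n k -> rc n.+1 (fun e => F (behead e) (head 0 e)) ->
  rc n (fun e => \sum_(0 <= i < k e) F e i).
Proof.
move=> Hk HF.
apply: rc_ext (rc_rec (s := fun e i r => r + F e i) Hk (rc_const n 0) _) => [v|].
  elim: (k v) => [|m IH] /=; first by rewrite big_geq.
  by rewrite IH big_nat_recr.
apply: rc_add; first by rc_var.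
(* the accumulator, which is the second variable of the step, is skipped *)
have HG (i : 'I_n.+1) : rc n.+2 (fun e => nth 0 e (if i == 0 :> nat then 0 else i.+1)).
  by apply: rc_nth; case: i => -[|i] /=.
apply: rc_ext (rc_comp HF HG) => -[[|a [|b v]] // sz].
rewrite enum_ordSl /= -map_comp; congr F.
apply: (@eq_from_nth _ 0).
  by rewrite size_map size_enum_ord; move: sz => /eqP [].
move=> i; rewrite size_map size_enum_ord => lt_in.
by rewrite (nth_map (Ordinal lt_in)) ?size_enum_ord //= nth_enum_ord.
Qed.

Lemma rc_mul n f g : rc n f -> rc n g -> rc n (fun e => f e * g e).
Proof.
move=> Hf Hg.
apply: rc_ext (rc_sum (F := fun e _ => g e) Hf _) => [v|].
  by rewrite sum_nat_const_nat subn0.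
exact: rc_behead.
Qed.

Lemma rc_exp n f g : rc n f -> rc n g -> rc n (fun e => f e ^ g e).
Proof.
move=> Hf Hg.
apply: rc_ext (rc_rec (s := fun e _ r => f e * r) Hg (rc_const n 1) _) => [v|].
  by elim: (g v) => [|m IH] /=; rewrite ?expn0 // IH expnS.
apply: rc_mul; first exact: rc_behead (rc_behead Hf).
by rc_var.
Qed.

Lemma rc_leq n f g : rc n f -> rc n g -> rc n (fun e => (f e <= g e) : nat).
Proof.
move=> Hf Hg.
apply: rc_ext (rc_sub (rc_const n 1) (rc_sub Hf Hg)) => v.
by rewrite /leq; case: (f v - g v).
Qed.

Lemma rc_and n (f g : seq nat -> bool) :
  rc n (fun e => f e : nat) -> rc n (fun e => g e : nat) ->
  rc n (fun e => (f e && g e) : nat).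
Proof.
by move=> Hf Hg; apply: rc_ext (rc_mul Hf Hg) => v; rewrite mulnb.
Qed.

Lemma rc_neg n (f : seq nat -> bool) :
  rc n (fun e => f e : nat) -> rc n (fun e => ~~ f e : nat).
Proof.
by move=> Hf; apply: rc_ext (rc_sub (rc_const n 1) Hf) => v; case: (f v).
Qed.

Lemma rc_or n (f g : seq nat -> bool) :
  rc n (fun e => f e : nat) -> rc n (fun e => g e : nat) ->
  rc n (fun e => (f e || g e) : nat).
Proof.
move=> Hf Hg; apply: rc_ext (rc_neg (rc_and (rc_neg Hf) (rc_neg Hg))) => v.
by rewrite -negb_or negbK.
Qed.

Lemma rc_eq n f g : rc n f -> rc n g -> rc n (fun e => (f e == g e) : nat).
Proof.
move=> Hf Hg; apply: rc_ext (rc_and (rc_leq Hf Hg) (rc_leq Hg Hf)) => v.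
by rewrite eqn_leq.
Qed.

(** Over nat and not over ordinals, for the sake of unification in [rc_ex]. *)
Definition ex_below (k : nat) (P : nat -> bool) := has P (iota 0 k).

Lemma ex_belowP k (P : nat -> bool) : reflect (exists2 i, i < k & P i) (ex_below k P).
Proof.
apply: (iffP hasP) => -[i].
- by rewrite mem_iota => lt_ik Pi; exists i.
- by exists i; rewrite ?mem_iota.
Qed.

Lemma rc_ex n k (F : seq nat -> nat -> bool) :
  rc n k -> rc n.+1 (fun e => F (behead e) (head 0 e) : nat) ->
  rc n (fun e => ex_below (k e) (fun i => F e i) : nat).
Proof.
move=> Hk HF.
apply: rc_ext (rc_leq (rc_const n 1) (rc_sum (F := fun e i => F e i) Hk HF)) => v.
rewrite lt0n big_mkord sum_nat_eq0 negb_forall; congr nat_of_bool.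
apply/existsP/ex_belowP => [[i Fi]|[i lt_ik Fi]].
  by exists i => //; case: (F v i) Fi.
by exists (Ordinal lt_ik) => /=; rewrite Fi.
Qed.

Lemma rc_odd n f : rc n f -> rc n (fun e => odd (f e) : nat).
Proof.
move=> Hf.
apply: rc_ext (rc_rec (s := fun e _ r => 1 - r) Hf (rc_const n 0) _) => [v|].
  by elim: (f v) => //= m ->; case: (odd m).
by apply: rc_sub; [exact: rc_const | rc_var].
Qed.

Definition bit z i := odd (z %/ 2 ^ i).

Lemma divn_count n d : 0 < d -> n %/ d = \sum_(0 <= i < n) (i.+1 * d <= n).
Proof.
move=> d0; rewrite (@big_cat_nat _ _ _ (n %/ d)) //=; last exact: leq_div.
rewrite [X in _ + X]big1_seq ?addn0.
  rewrite (eq_big_nat _ _ (F2 := fun=> 1)) ?sum_nat_const_nat ?muln1 ?subn0 //.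
  by move=> i /andP[_ lti]; rewrite -leq_divRL // lti.
move=> i; rewrite mem_index_iota => /andP[_ /andP[lei _]].
by rewrite -leq_divRL // ltnNge lei.
Qed.

Lemma rc_bit n f g : rc n f -> rc n g -> rc n (fun e => bit (f e) (g e) : nat).
Proof.
move=> Hf Hg; apply: rc_odd.
apply: rc_ext (rc_sum (k := f) (F := fun e i => (i.+1 * 2 ^ g e <= f e) : nat) Hf _) => [v|].
  by rewrite divn_count ?expn_gt0.
apply: rc_leq; last exact: rc_behead.
apply: rc_mul; first by apply/rc_S/rc_head.
by apply: rc_exp; [exact: rc_const|exact: rc_behead].
Qed.

Lemma computable2_rc phi : computable2 phi -> rc2 phi.
Proof.
apply: partrec_ext => v y; rewrite !(tnth_nth 0) /=.
by case: v => -[|a [|b s]].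
Qed.

(* Hypotheses come first: otherwise the other lemmas would unfold the functions
   that the hypotheses are about. *)
Ltac rc_step := first
  [ assumption | exact: rc_const | rc_var
  | match goal with
    | H : rc2 ?f |- _ => apply: (rc_app2 H)
    | H : rc1 ?f |- _ => apply: (rc_app1 H)
    end
  | apply: rc_ex | apply: rc_sum | apply: rc_bit | apply: rc_odd
  | apply: rc_eq | apply: rc_or | apply: rc_and | apply: rc_neg | apply: rc_leq
  | apply: rc_exp | apply: rc_mul | apply: rc_sub | apply: rc_add
  | apply: rc_S | apply: rc_pred ].
Ltac rc_tac := rewrite /rc1 /rc2; repeat rc_step.

(** * Tests passed by complex sequences *)

(** Minimization is the only source of partiality: searching for a zero of the
    constant function with value ~~ d succeeds at once or not at all. *)
Lemma partrec_guard n (d : seq nat -> bool) f :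
  rc n (fun e => d e : nat) -> rc n f ->
  @partrec n (fun v y => d v /\ y = f v).
Proof.
move=> Hd Hf.
have Hmu := partrec_mu (rc_behead (rc_neg Hd)).
have H2 : rc2 (fun a b => a + b) by rc_tac.
pose G (i : 'I_2) : pfun n := if i == 0 :> nat then (fun v y => y = f v)
  else (fun v y => 0 = ~~ d (behead (y :: v)) /\
     forall z, z < y -> exists u, u.+1 = ~~ d (behead (z :: v))).
have HG i : partrec (G i) by rewrite /G; case: ifP.
apply: partrec_ext (partrec_comp H2 HG) => v y; split.
- move=> [w [Gw ->]].
  have := Gw ord0; have := Gw ord_max; rewrite /G /= !(tnth_nth 0) /=.
  case: w {Gw} => -[|a [|b []]] //= _ [dv hz] ->.
  have d_v : d v by case: (d v) dv.
  split=> //; case: b hz {dv} => [|b] /=; first by rewrite addn0.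
  by move=> /(_ 0 isT)[u]; rewrite d_v.
- move=> [dv ->]; exists [tuple f v; 0]; split; last by rewrite /= addn0.
  case=> -[|[|//]] lt; rewrite /G /= (tnth_nth 0) //=.
  by rewrite dv.
Qed.

Lemma sum_uniq N (P : nat -> bool) F i0 : i0 < N -> P i0 ->
  (forall i, i < N -> P i -> i = i0) ->
  \sum_(0 <= i < N) P i * F i = F i0.
Proof.
move=> lt_i0 Pi0 uniq_i0; rewrite big_mkord (bigD1 (Ordinal lt_i0)) //= Pi0 mul1n.
rewrite big1 ?addn0 // => i ne_i; case Pi: (P i) => //.
by move: ne_i; rewrite -val_eqE /= (uniq_i0 i) ?eqxx.
Qed.

Lemma bit_cons (b : bool) z i :
  bit (b + z.*2) i = if i is j.+1 then bit z j else b.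
Proof.
case: i => [|i]; rewrite /bit; first by rewrite expn0 divn1 oddD odd_double oddb addbF.
by rewrite expnS divnMA divn2 half_bit_double.
Qed.

(** One more than the code of s is the binary numeral s, least significant digit
    first, followed by a leading 1. *)
Lemma bit_code (s : string) i : i < size s -> bit (code s).+1 i = nth false s i.
Proof.
elim: s i => [|b s IH] //= i.
have -> : ((code s).*2 + b.+1).+1 = b + (code s).+1.*2.
  by rewrite doubleS addnS addnC !addnS.
by rewrite bit_cons; case: i => [|i] //=; rewrite ltnS => /IH.
Qed.

Lemma code_size s : 2 ^ size s <= (code s).+1 < 2 ^ (size s).+1.
Proof.
elim: s => [|b s] //=; rewrite !expnS; case: b => /=; lia.
Qed.

Lemma code_size_eq s m : 2 ^ m <= (code s).+1 < 2 ^ m.+1 -> size s = m.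
Proof.
move=> /andP[lo hi]; have /andP[lo' hi'] := code_size s.
apply/eqP; rewrite eqn_leq.
have := leq_ltn_trans lo hi'; have := leq_ltn_trans lo' hi.
by rewrite !ltn_exp2l // !ltnS => -> ->.
Qed.

(** A digit true doubles the code increased by 2. *)
Lemma code_prefix_true q w :
  (code (nseq q true ++ false :: w)).+2 = 2 ^ q * (2 * code w + 3).
Proof.
elim: q => [|q IH] /=; first by rewrite expn0; lia.
have -> : ((code (nseq q true ++ false :: w)).*2 + 2).+2
  = 2 * (code (nseq q true ++ false :: w)).+2 by lia.
by rewrite IH expnS mulnA.
Qed.

Lemma nseq_false_inj q q' w w' :
  prefix (nseq q true ++ false :: w) (nseq q' true ++ false :: w') ->
  q = q' /\ prefix w w'.
Proof.
elim: q q' => [|q IH] [|q'] //=.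
by move=> /IH[-> ?].
Qed.

Section Test.
Variables (m : nat -> nat) (bad : nat -> nat -> bool).
Hypotheses (Hm : rc1 m) (Hbad : rc2 (fun q z => bad q z : nat)).

Definition index_len q := m q - 2 * q.

(** A string x of length m q is represented by (code x).+1; these are exactly the
    numbers with m q + 1 binary digits. *)
Definition candidate q z := (2 ^ m q <= z) && bad q z.

Definition rank q z := \sum_(0 <= y < z) candidate q y.

Definition nth_bad q idx :=
  \sum_(0 <= z < 2 ^ (m q).+1) (candidate q z && (rank q z == idx)) * z.-1.

(** The code of the program for q and idx, see [program_codeE]. *)
Definition program_code q idx := 2 ^ q * (2 * idx + 2 ^ (index_len q).+1 + 1) - 2.

(** The program consists of q in unary and of a word w of fixed length, which is
    an index into the list of the bad strings. The length of w depends on q only,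
    and this makes the set of programs prefix-free. *)
Definition test_machine : machine := fun p x =>
  exists q w, [/\ p = nseq q true ++ false :: w, size w = index_len q &
    code x = nth_bad q ((code w).+1 - 2 ^ index_len q)].

Lemma program_codeE q w : size w = index_len q ->
  program_code q ((code w).+1 - 2 ^ index_len q) = code (nseq q true ++ false :: w).
Proof.
move=> sw; have := code_prefix_true q w; rewrite /program_code => E.
have /andP[] := code_size w; rewrite sw => lo hi.
have -> : 2 * ((code w).+1 - 2 ^ index_len q) + 2 ^ (index_len q).+1 + 1 = 2 * code w + 3.
  by rewrite expnS; lia.
lia.
Qed.

Lemma idx_word q idx : idx < 2 ^ index_len q ->
  exists2 w, size w = index_len q & (code w).+1 - 2 ^ index_len q = idx.
Proof.
move=> lt_idx; have [dec _ decK] := code_bij.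
have p0 : 0 < 2 ^ index_len q by rewrite expn_gt0.
have E : (code (dec (idx + 2 ^ index_len q).-1)).+1 = idx + 2 ^ index_len q.
  by rewrite decK prednK // addn_gt0 p0 orbT.
exists (dec (idx + 2 ^ index_len q).-1); last by rewrite E addnK.
by apply: code_size_eq; rewrite E expnS; lia.
Qed.

Lemma word_idx q w : size w = index_len q -> (code w).+1 - 2 ^ index_len q < 2 ^ index_len q.
Proof.
move=> sw; have := code_size w; rewrite sw expnS.
have p0 : 0 < 2 ^ index_len q by rewrite expn_gt0.
lia.
Qed.

Lemma test_machine_prefix_free : prefix_free test_machine.
Proof.
move=> p p' x x' [q [w [-> sw _]]] [q' [w' [-> sw' _]]] pre.
have [eq_q /prefixP[t Et]] := nseq_false_inj pre.
subst q'; move: sw'; rewrite Et size_cat sw => /eqP.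
by rewrite -{2}[index_len q]addn0 eqn_add2l => /nilP ->; rewrite cats0.
Qed.

Lemma program_code_inj q q' idx idx' : idx < 2 ^ index_len q -> idx' < 2 ^ index_len q' ->
  program_code q idx = program_code q' idx' -> q = q' /\ idx = idx'.
Proof.
move=> /idx_word[w sw <-] /idx_word[w' sw' <-]; rewrite !program_codeE //.
move=> /(bij_inj code_bij) E.
have [eq_q _] : q = q' /\ prefix w w'.
  by apply: nseq_false_inj; rewrite E prefix_refl.
subst q'; split=> //; move/eqP: E; rewrite eqseq_cat // eqxx /= => /eqP[->].
by [].
Qed.

Lemma program_code_ge q idx : q <= program_code q idx.
Proof.
rewrite /program_code expnS.
have lt_q : q < 2 ^ q by apply: ltn_expl.
have p0 : 0 < 2 ^ index_len q by rewrite expn_gt0.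
nia.
Qed.

(** Instead of parsing a program, the machine searches for the pair (q, idx) that
    encodes it, below the bound given by [program_code_ge]. *)
Lemma test_machine_computable : computable_machine test_machine.
Proof.
pose hit n q idx := program_code q idx == n.
pose val n := \sum_(0 <= q < n.+1) ex_below (2 ^ index_len q) (hit n q) *
  \sum_(0 <= idx < 2 ^ index_len q) hit n q idx * nth_bad q idx.
pose ok n := ex_below n.+1 (fun q => ex_below (2 ^ index_len q) (hit n q)).
have Hlen : rc1 index_len by rewrite /index_len; rc_tac.
have Hcand : rc2 (fun q z => candidate q z : nat) by rewrite /candidate; rc_tac.
have Hrank : rc2 rank by rewrite /rank; rc_tac.
have Hnth : rc2 nth_bad by rewrite /nth_bad; rc_tac.
have Henc : rc2 program_code by rewrite /program_code; rc_tac.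
have Hok : rc1 (fun n => ok n : nat) by rewrite /ok /hit; rc_tac.
have Hval : rc1 val. rewrite /val /hit; rc_tac.
exists (fun v y => ok (head 0 v) /\ y = val (head 0 v)).
  exact: (partrec_guard (d := fun e => ok (head 0 e)) Hok Hval).
have valE q idx : idx < 2 ^ index_len q -> val (program_code q idx) = nth_bad q idx.
  move=> lt_idx; rewrite /val.
  rewrite (@sum_uniq _ (fun r => ex_below (2 ^ index_len r) (hit (program_code q idx) r)) _ q).
  - rewrite (@sum_uniq _ (hit (program_code q idx) q) (nth_bad q) idx lt_idx) //.
    + exact: eqxx.
    + by move=> i lti /eqP/(program_code_inj lti lt_idx)[].
  - by rewrite ltnS program_code_ge.
  - by apply/ex_belowP; exists idx => //; apply: eqxx.
  - move=> r _ /ex_belowP[i lti /eqP].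
    by move=> /(program_code_inj lti lt_idx)[].
move=> p x /=; split.
- move=> [q [w [-> sw ->]]]; have lt_i := word_idx sw.
  rewrite -(program_codeE sw) valE //; split=> //.
  apply/ex_belowP; exists q; first by rewrite ltnS program_code_ge.
  by apply/ex_belowP; exists ((code w).+1 - 2 ^ index_len q) => //; apply: eqxx.
- move=> [/ex_belowP[q _ /ex_belowP[idx lt_idx /eqP E]]]; rewrite -E valE //.
  have [w sw Ew] := idx_word lt_idx; rewrite -Ew program_codeE // in E *.
  move=> Ex; exists q, w; split=> //.
  exact/esym/(bij_inj code_bij).
Qed.

Lemma rank_lt q z c : candidate q z -> z < 2 ^ (m q).+1 ->
  \sum_(0 <= y < 2 ^ (m q).+1) candidate q y <= c -> rank q z < c.
Proof.
move=> cz lt_z; apply: leq_trans.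
rewrite (@big_cat_nat _ _ _ z.+1) //= big_nat_recr //= cz addn1.
by rewrite ltnS -/(rank q z) leq_addr.
Qed.

Lemma nth_bad_rank q z : candidate q z -> z < 2 ^ (m q).+1 ->
  nth_bad q (rank q z) = z.-1.
Proof.
move=> cz lt_z.
rewrite /nth_bad (@sum_uniq _ (fun y => candidate q y && (rank q y == rank q z)) predn z lt_z) //.
  by rewrite cz eqxx.
move=> y lt_y /andP[cy /eqP Er].
have rank_mono a b : candidate q a -> a < b -> rank q a < rank q b.
  move=> ca lt_ab; rewrite /rank [X in _ < X](@big_cat_nat _ _ _ a.+1) //=.
  by rewrite big_nat_recr //= ca addn1 ltnS leq_addr.
case: (ltngtP y z) => // [/(rank_mono _ _ cy)|/(rank_mono _ _ cz)];
  by rewrite Er ltnn.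
Qed.

Lemma sum_candidate_le q :
  \sum_(0 <= y < 2 ^ (m q).+1) candidate q y <=
  #|[set x : (m q).-tuple bool | bad q (code x).+1]|.
Proof.
have [dec _ decK] := code_bij.
rewrite big_mkord.
pose word (y : nat) : (m q).-tuple bool := insubd [tuple of nseq (m q) false] (dec y.-1).
have wordK (y : nat) : y < 2 ^ (m q).+1 -> candidate q y ->
    val (word y) = dec y.-1 /\ (code (dec y.-1)).+1 = y.
  move=> lt_y /andP[le_y _].
  have y0 : 0 < y by apply: leq_trans le_y; rewrite expn_gt0.
  have E : (code (dec y.-1)).+1 = y by rewrite decK prednK.
  split=> //; rewrite val_insubd; case: ifP => // /eqP; case.
  by apply: code_size_eq; rewrite E le_y.
have <- : #|[set y : 'I_(2 ^ (m q).+1) | candidate q y]| =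
  \sum_(i < 2 ^ (m q).+1) candidate q i.
  by rewrite -sum1_card big_mkcond; apply: eq_bigr => i _; rewrite inE; case: ifP.
have inj : {in [set y : 'I_(2 ^ (m q).+1) | candidate q y] &, injective (fun y : 'I__ => word y)}.
  move=> a b; rewrite !inE => ca cb /(congr1 val) E; apply: val_inj.
  have [Ea Fa] := wordK a (ltn_ord a) ca; have [Eb Fb] := wordK b (ltn_ord b) cb.
  by rewrite /= -Fa -Fb -Ea -Eb E.
rewrite -(card_in_imset inj); apply: subset_leq_card.
apply/fintype.subsetP => x0 /imsetP[y + ->]; rewrite !inE => cy.
have [-> ->] := wordK y (ltn_ord y) cy.
by case/andP: cy.
Qed.

(** The program of a bad prefix of length m q has length m q - q + 1, which is
    less than complexity allows when q is large. *)
Lemma KC_test (U : machine) (alpha : nat -> bool) q1 :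
  universal U -> KC U alpha ->
  (forall q, q1 <= q -> 2 * q <= m q /\
    #|[set x : (m q).-tuple bool | bad q (code x).+1]| <= 2 ^ (m q - 2 * q)) ->
  exists q0, forall q, q0 <= q -> ~~ bad q (code (mkseq alpha (m q))).+1.
Proof.
move=> [_ univU] [k Hk] Hcount.
have [|c Hc] := univU test_machine.
  by split; [exact: test_machine_computable|exact: test_machine_prefix_free].
exists (maxn q1 (k + c + 2)) => q; rewrite geq_max => /andP[le1 le2].
apply/negP => badq; set x := mkseq alpha (m q) in badq.
have [le_m card_le] := Hcount q le1.
have sx : size x = m q by rewrite size_mkseq.
have /andP[lo hi] := code_size x; rewrite sx in lo hi.
have cx : candidate q (code x).+1 by rewrite /candidate lo.
have lt_r : rank q (code x).+1 < 2 ^ index_len q.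
  apply: rank_lt => //; exact: leq_trans (sum_candidate_le q) card_le.
have [w sw Ew] := idx_word lt_r.
have /Hc[p Up sp] : test_machine (nseq q true ++ false :: w) x.
  by exists q, w; split=> //; rewrite Ew nth_bad_rank.
have := Hk (m q); rewrite -/x.
have : K U x <= size p.
  rewrite /K; case: pselect => // ex; case: ex_minnP => n _; apply.
  by apply/asboolP; exists p.
move: sp; rewrite size_cat size_nseq /= sw /index_len; lia.
Qed.

End Test.

(** * Betting on fair signs *)

Section Betting.
Local Open Scope ring_scope.
Variable F : realFieldType.

Lemma bernoulli_ineq (x : F) n : -1 <= x -> 1 + x *+ n <= (1 + x) ^+ n.
Proof.
move=> x1; elim: n => [|n IH]; first by rewrite mulr0n addr0 expr0.
rewrite exprS; apply: le_trans (ler_wpM2l _ IH); last lra.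
rewrite -(mulr_natr x n.+1) -(mulr_natr x n) -natr1.
have := mulr_ge0 (ler0n F n) (sqr_ge0 x).
nra.
Qed.

Variables (X : finType) (v : nat -> X -> bool) (f : nat -> X -> X) (K : nat).
Hypothesis f_inj : forall k, injective (f k).
Hypothesis v_fix : forall k i x, (i < k < K)%N -> v i (f k x) = v i x.
Hypothesis v_flip : forall k x, (k < K)%N -> v k (f k x) = ~~ v k x.

(** The capital of a gambler who stakes the fraction s on each sign has constant
    mean: f k is a symmetry of the space that preserves the past and changes
    the k-th sign, so the expected gain of the k-th bet vanishes. *)
Lemma betting_sum (s : F) :
  \sum_x \prod_(0 <= i < K) (1 + (-1) ^+ v i x * s) = #|X|%:R.
Proof.
have : (K <= K)%N by [].
elim: {1 3}K => [|k IH] le_kK.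
  under eq_bigr do rewrite big_geq //.
  by rewrite sumr_const.
rewrite -IH; last exact: ltnW.
under eq_bigr do rewrite big_nat_recr //= mulrDr mulr1.
rewrite big_split /= -[RHS]addr0; congr (_ + _).
set S := (LHS).
suff : S = - S by move=> /eqP; rewrite -addr_eq0 -mulr2n mulrn_eq0 => /eqP.
rewrite {1}/S (reindex_inj (@f_inj k)) /= -sumrN; apply: eq_bigr => x _.
rewrite v_flip // signrN !mulNr mulrN; congr (- (_ * _)).
apply: eq_big_nat => i /andP[_ lt_ik]; rewrite v_fix //.
by rewrite lt_ik.
Qed.

(** Where few of the v_i hold, the capital of [betting_sum] is large, and this is
    Markov's inequality for it. *)
Lemma betting_tail (s : F) lam : 0 < s -> s < 1 ->
  #|[set x | 2 * (\sum_(0 <= i < K) v i x) + lam <= K]%N|%:R *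
  ((1 - s ^+ 2) ^+ K * (1 + s) ^+ lam) <= #|X|%:R.
Proof.
move=> s0 s1; rewrite -(betting_sum s) mulr_natl -sumr_const.
rewrite [leLHS]big_mkcond /=; apply: ler_sum => x _.
have prod_ge0 : 0 <= \prod_(0 <= i < K) (1 + (-1) ^+ v i x * s).
  by apply: prodr_ge0 => i _; case: (v i x); rewrite ?expr0 ?expr1; lra.
case: ifP => //; rewrite inE => le_K.
set c := (\sum_(0 <= i < K) v i x)%N in le_K.
have prodE n : \prod_(0 <= i < n) (1 + (-1) ^+ v i x * s) =
  (1 - s) ^+ (\sum_(0 <= i < n) v i x)%N * (1 + s) ^+ (n - \sum_(0 <= i < n) v i x)%N.
  elim: n => [|n IH]; first by rewrite !big_geq // !expr0 mul1r.
  rewrite !big_nat_recr //= IH.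
  have le_n : (\sum_(0 <= i < n) v i x <= n)%N.
    rewrite -[leqRHS]mul1n -[X in (_ <= 1 * X)%N]subn0 mulnC -sum_nat_const_nat.
    by apply: leq_sum => i _; case: (v i x).
  case: (v n x); rewrite ?addn0 ?addn1 ?expr0 ?expr1.
    by rewrite subSS exprSr; ring.
  by rewrite subSn // exprSr; ring.
rewrite prodE -/c.
have -> : (K - c = c + (K - 2 * c))%N by lia.
rewrite exprD mulrA -exprMn.
have -> : (1 - s) * (1 + s) = 1 - s ^+ 2 by ring.
have p0 : 0 <= 1 - s ^+ 2 by nra.
have p1 : 1 - s ^+ 2 <= 1 by nra.
apply: ler_pM; rewrite ?exprn_ge0 //; first lra.
- by apply: ler_wiXn2l => //; lia.
- by apply: ler_weXn2l; [lra|lia].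
Qed.

(** The same inequality for the bold gambler, s = 1. *)
Lemma all_false : #|[set x | \sum_(0 <= i < K) v i x == 0]%N|%:R * 2 ^+ K <= #|X|%:R :> F.
Proof.
rewrite -(betting_sum 1) mulr_natl -sumr_const.
rewrite [leLHS]big_mkcond /=; apply: ler_sum => x _.
case: ifP.
- rewrite inE sum_nat_seq_eq0 => /allP all0.
  rewrite (eq_big_nat _ _ (F2 := fun=> 2)); first by rewrite prodr_const_nat subn0.
  move=> i lti; have := all0 i; rewrite mem_index_iota lti => /(_ isT) /=.
  by case: (v i x); rewrite // expr0 mul1r => _; ring.
- by move=> _; apply: prodr_ge0 => i _; case: (v i x); rewrite ?expr0 ?expr1; lra.
Qed.

End Betting.

(** * Walsh functions of the digits *)

(** psi n i is the position in y of the i-th digit of the n-th number, and the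
    binary digits of S select a set of indices below L; the parity of this
    number is the Walsh function of S at the n-th number. *)
Definition walsh (psi : nat -> nat -> nat) (L S : nat) (y : nat -> bool) n : nat :=
  \sum_(0 <= i < L) (bit S i && y (psi n i)).

(** The union bound. *)
Lemma card_ex_below (X : finType) N B (P : X -> nat -> bool) :
  (forall i, i < N -> #|[set x | P x i]| <= B) ->
  #|[set x | ex_below N (P x)]| <= N * B.
Proof.
elim: N => [|N IH] HB.
  by rewrite leqn0 cards_eq0; apply/eqP/setP => x; rewrite !inE.
have -> : [set x | ex_below N.+1 (P x)] = [set x | ex_below N (P x)] :|: [set x | P x N].
  apply/setP => x; rewrite !inE /ex_below -{1}addn1 iotaD has_cat /= orbF.
  by rewrite add0n.
apply: leq_trans (leq_card_setU _ _) _; rewrite mulSn addnC leq_add ?HB //.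
by apply: IH => i lti; apply: HB; apply: ltnW.
Qed.

Lemma bit_lt S i : bit S i -> 2 ^ i <= S.
Proof.
by rewrite /bit leqNgt; apply: contraL => /divn_small ->.
Qed.

Lemma bit_ex S : 0 < S -> exists i, bit S i.
Proof.
elim/ltn_ind: S => S IH S0; case: (boolP (odd S)) => oS.
  by exists 0; rewrite /bit expn0 divn1.
have [||i Hi] := IH S./2.
- by rewrite ltn_half_double -addnn; lia.
- by rewrite half_gt0; case: S oS S0 {IH} => [|[|]].
by exists i.+1; move: Hi; rewrite /bit expnS divnMA divn2.
Qed.

Definition nat_of_bits (b : nat -> bool) L : nat :=
  \sum_(0 <= i < L) b i * 2 ^ i.

Lemma nat_of_bitsS b L : nat_of_bits b L.+1 = b 0 + (nat_of_bits (fun i => b i.+1) L).*2.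
Proof.
rewrite /nat_of_bits big_nat_recl // expn0 muln1; congr (_ + _).
rewrite -muln2 big_distrl /=; apply: eq_bigr => i _.
by rewrite expnSr mulnA.
Qed.

Lemma bit_nat_of_bits b L i : i < L -> bit (nat_of_bits b L) i = b i.
Proof.
elim: L b i => // L IH b [|i]; rewrite nat_of_bitsS bit_cons // ltnS => lt_iL.
exact: IH.
Qed.

Lemma nat_of_bits_lt b L : nat_of_bits b L < 2 ^ L.
Proof.
elim: L b => [|L IH] b; first by rewrite /nat_of_bits big_geq.
rewrite nat_of_bitsS expnS; have := IH (fun i => b i.+1); case: (b 0); lia.
Qed.

Lemma odd_sum_addb L (P : nat -> bool) :
  odd (\sum_(0 <= i < L) P i) = \big[addb/false]_(0 <= i < L) P i.
Proof.
by rewrite (big_morph odd oddD (erefl _)); apply: eq_bigr => i _; rewrite oddb.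
Qed.

Section Flip.
Variable psi : nat -> nat -> nat.
Hypothesis psi_inj : forall n i n' i', psi n i = psi n' i' -> n = n' /\ i = i'.

Definition flip_at p (y : nat -> bool) : nat -> bool := fun j => y j (+) (j == p).

(** Since psi is injective, changing the digit of index i0 of the n0-th number
    alters the Walsh functions of that number only. *)
Lemma odd_walsh_flip_at L S y n n0 i0 : i0 < L -> bit S i0 ->
  odd (walsh psi L S (flip_at (psi n0 i0) y) n) = odd (walsh psi L S y n) (+) (n == n0).
Proof.
move=> lt_i0 S_i0.
rewrite /walsh !odd_sum_addb /flip_at.
have -> : (n == n0) = \big[addb/false]_(0 <= i < L) ((i == i0) && (n == n0)).
  rewrite big_mkord (bigD1 (Ordinal lt_i0)) //= eqxx /= big1 ?addbF // => i.
  by rewrite -val_eqE /= => /negbTE ->.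
rewrite -big_split /=; apply: eq_bigr => i _.
have -> : (psi n i == psi n0 i0) = (i == i0) && (n == n0).
  by apply/eqP/andP => [/psi_inj[-> ->]|[/eqP -> /eqP ->]].
case: eqP => [->|_]; first by rewrite S_i0.
by rewrite !addbF.
Qed.

Definition flip m p (x : m.-tuple bool) : m.-tuple bool :=
  [tuple tnth x i (+) (i == p :> nat) | i < m].

Lemma flip_inj m p : injective (@flip m p).
Proof.
apply: inv_inj => x; apply: eq_from_tnth => i.
by rewrite !tnth_mktuple -addbA addbb addbF.
Qed.

Definition bits m (x : m.-tuple bool) : nat -> bool := fun p => nth false x p.

Lemma bits_flip m p (x : m.-tuple bool) j : p < m ->
  bits (flip p x) j = flip_at p (bits x) j.
Proof.
move=> lt_pm; rewrite /bits /flip_at; case: (ltnP j m) => [lt_jm|le_mj].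
  by rewrite -!(tnth_nth _ _ (Ordinal lt_jm)) tnth_mktuple.
rewrite !nth_default ?size_tuple //; case: eqP => // E.
by move: lt_pm; rewrite -E ltnNge le_mj.
Qed.

Lemma bits_code m (x : m.-tuple bool) p : p < m -> bit (code x).+1 p = bits x p.
Proof. by move=> lt_pm; rewrite bit_code ?size_tuple. Qed.

Lemma eq_walsh L S y y' n : (forall i, i < L -> y (psi n i) = y' (psi n i)) ->
  walsh psi L S y n = walsh psi L S y' n.
Proof.
by move=> E; apply: eq_big_nat => i /andP[_ lti]; rewrite E.
Qed.

Lemma odd_walsh_flip m L S (x : m.-tuple bool) n n0 i0 :
  psi n0 i0 < m -> i0 < L -> bit S i0 ->
  odd (walsh psi L S (bits (flip (psi n0 i0) x)) n) =
  odd (walsh psi L S (bits x) n) (+) (n == n0).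
Proof.
move=> lt_m lt_i0 S_i0; rewrite -(odd_walsh_flip_at _ _ _ lt_i0 S_i0); congr odd.
by apply: eq_walsh => i _; apply: bits_flip.
Qed.

(** The number of n < K for which the Walsh signs of n and n + d differ; hence
    K - 2 * ndiff is an autocorrelation, see [autocorrelation]. *)
Definition ndiff L S y d K : nat :=
  \sum_(0 <= n < K) odd (walsh psi L S y n + walsh psi L S y (n + d)).

Definition unbalanced L S y d K lam : bool :=
  (2 * ndiff L S y d K + lam <= K) || (K + lam <= 2 * ndiff L S y d K).

(** The products of the signs at n and n + d, for n < K, are fair bets: if i0
    belongs to S, then changing the digit of index i0 of the number k + d
    changes the k-th product and none of the earlier ones, because d > 0. *)
Lemma card_unbalanced (F : realFieldType) m L S d K lam (s : F) :
  (forall n i, n < K + d -> i < L -> psi n i < m) ->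
  0 < S < 2 ^ L -> 0 < d -> (0 < s)%R -> (s < 1)%R ->
  (#|[set x : m.-tuple bool | unbalanced L S (bits x) d K lam]|%:R *
  ((1 - s ^+ 2) ^+ K * (1 + s) ^+ lam) <= (2 ^ m.+1)%N%:R :> F)%R.
Proof.
move=> lt_m /andP[S0 lt_S] d0 s0 s1.
have [i0 Si0] := bit_ex S0.
have lt_i0 : i0 < L.
  by rewrite -(ltn_exp2l _ _ (isT : 1 < 2)); apply: leq_ltn_trans (bit_lt Si0) lt_S.
pose v n (x : m.-tuple bool) :=
  odd (walsh psi L S (bits x) n + walsh psi L S (bits x) (n + d)).
pose f k := @flip m (psi (k + d) i0).
have f_inj k : injective (f k) by apply: flip_inj.
have vf i k x : i <= k < K -> v i (f k x) = v i x (+) (i == k).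
  move=> /andP[le_ik lt_kK]; rewrite /v /f !oddD !odd_walsh_flip //; last 2 first.
  - by apply: lt_m; rewrite // ltn_add2r.
  - by apply: lt_m; rewrite // ltn_add2r.
  rewrite eqn_add2r.
  have -> : (i == k + d) = false by apply/eqP; lia.
  by rewrite addbF addbA.
have v_fix k i x : i < k < K -> v i (f k x) = v i x.
  move=> /andP[lt_ik lt_kK]; rewrite vf ?(ltnW lt_ik) //.
  by rewrite (ltn_eqF lt_ik) addbF.
have v_flip k x : k < K -> v k (f k x) = ~~ v k x.
  by move=> lt_kK; rewrite vf ?leqnn // eqxx addbT.
have cardX : #|{: m.-tuple bool}| = 2 ^ m by rewrite card_tuple card_bool.
have C1 := betting_tail f_inj v_fix v_flip lam s0 s1.
have C2 := @betting_tail F _ (fun n x => ~~ v n x) f K f_inj _ _ s lam s0 s1.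
have {}C2 := C2 (fun k i x h => congr1 negb (v_fix k i x h)) (fun k x h => congr1 negb (v_flip k x h)).
rewrite !cardX in C1 C2.
set A := [set x | _] in C1; set B := [set x | _] in C2; set Cc := [set x | _].
have sub : Cc \subset A :|: B.
  apply/fintype.subsetP => x; rewrite !inE => /orP[->//|hx]; apply/orP; right.
  have : \sum_(0 <= n < K) ~~ v n x + ndiff L S (bits x) d K = K.
    rewrite /ndiff -big_split /= (eq_bigr (fun=> 1)) ?sum_nat_const_nat ?subn0 ?muln1 //.
    by move=> n _; rewrite -/(v n x); case: (v n x).
  by move: hx; set a := ndiff _ _ _ _ _; set b := (\sum_(0 <= n < K) _); lia.
have w0 : (0 <= (1 - s ^+ 2) ^+ K * (1 + s) ^+ lam)%R.
  by rewrite mulr_ge0 ?exprn_ge0 //; nra.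
have le_card : (#|Cc|%:R <= #|A|%:R + #|B|%:R :> F)%R.
  rewrite -natrD ler_nat; apply: leq_trans (leq_card_setU _ _).
  exact: subset_leq_card.
apply: le_trans (ler_wpM2r w0 le_card) _.
rewrite mulrDl expnS mul2n -addnn natrD; exact: lerD.
Qed.

Lemma card_constant m n T :
  (forall i, i < T -> psi n i < m) ->
  #|[set x : m.-tuple bool | (\sum_(0 <= i < T) bits x (psi n i) == 0) ||
      (\sum_(0 <= i < T) bits x (psi n i) == T)]| * 2 ^ T <= 2 ^ m.+1.
Proof.
move=> lt_m.
pose v i (x : m.-tuple bool) := bits x (psi n i).
pose f k := @flip m (psi n k).
have f_inj k : injective (f k) by apply: flip_inj.
have vf i k x : k < T -> v i (f k x) = v i x (+) (i == k).
  move=> lt_kT; rewrite /v /f bits_flip ?lt_m // /flip_at; congr addb.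
  by apply/eqP/eqP => [/psi_inj[]|->].
have v_fix k i x : i < k < T -> v i (f k x) = v i x.
  by move=> /andP[lt_ik lt_kT]; rewrite vf // (ltn_eqF lt_ik) addbF.
have v_flip k x : k < T -> v k (f k x) = ~~ v k x.
  by move=> lt_kK; rewrite vf // eqxx addbT.
have cardX : #|{: m.-tuple bool}| = 2 ^ m by rewrite card_tuple card_bool.
have C1 := @all_false rat _ v f T f_inj v_fix v_flip.
have C2 := @all_false rat _ (fun n x => ~~ v n x) f T f_inj
  (fun k i x h => congr1 negb (v_fix k i x h)) (fun k x h => congr1 negb (v_flip k x h)).
rewrite !cardX -natrX -natrM ler_nat in C1.
rewrite !cardX -natrX -natrM ler_nat in C2.
rewrite expnS mul2n -addnn; apply: leq_trans (leq_add C1 C2).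
rewrite -mulnDl leq_mul2r; apply/orP; right.
apply: leq_trans (leq_card_setU _ _); apply: subset_leq_card.
apply/fintype.subsetP => x; rewrite !inE => /orP[->//|hx]; apply/orP; right.
have : \sum_(0 <= i < T) ~~ v i x + \sum_(0 <= i < T) v i x = T.
  rewrite -big_split /= (eq_bigr (fun=> 1)) ?sum_nat_const_nat ?subn0 ?muln1 //.
  by move=> i _; case: (v i x).
by rewrite (eqP hx) /v; lia.
Qed.

End Flip.

(** * The two tests *)

Lemma expn_dominates C : exists q1, forall q, q1 <= q -> C * q + C <= 2 ^ q.
Proof.
have sq q : q * q <= 4 * 2 ^ q.
  elim: q => // -[|[|[|q]]] IH //.
  rewrite expnS; nia.
exists (16 * C + 16) => q le_q.
have := sq q; nia.
Qed.

Section Regular.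
Variable psi : nat -> nat -> nat.
Hypothesis psi_inj : forall n i n' i', psi n i = psi n' i' -> n = n' /\ i = i'.
Hypothesis psi_rc : rc2 psi.

(** The q-th tests concern all numbers of index below this bound, the first 2 q
    digits for the Walsh functions and tail_len q digits for the tails. *)
Definition horizon q := 2 ^ (18 * q.+1).
Definition tail_len q := 20 * q + 20.

(** An upper bound for all the positions that the tests inspect. *)
Definition prefix_len q := 2 * q +
  \sum_(0 <= n < 2 * horizon q) \sum_(0 <= i < tail_len q) (psi n i).+1.

Lemma psi_lt_prefix_len q n i : n < 2 * horizon q -> i < tail_len q -> psi n i < prefix_len q.
Proof.
move=> lt_n lt_i; rewrite /prefix_len big_mkord (bigD1 (Ordinal lt_n)) //=.
rewrite big_mkord (bigD1 (Ordinal lt_i)) //=; lia.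
Qed.

(** The threshold 2 ^ (10 q) is 2 ^ (q - 9) times the square root of the horizon. *)
Definition walsh_bad q (y : nat -> bool) :=
  ex_below (horizon q) (fun K => ex_below (horizon q) (fun d => ex_below (2 ^ (2 * q)) (fun S =>
    [&& 0 < d, 0 < S & unbalanced psi (2 * q) S y d K (2 ^ (10 * q))]))).

Definition tail_bad q (y : nat -> bool) :=
  ex_below (horizon q) (fun n =>
    (\sum_(0 <= i < tail_len q) y (psi n i) == 0) ||
    (\sum_(0 <= i < tail_len q) y (psi n i) == tail_len q)).

Lemma rc_prefix_len : rc1 prefix_len.
Proof. rewrite /prefix_len /horizon /tail_len; rc_tac. Qed.

Lemma rc_walsh_bad : rc2 (fun q z => walsh_bad q (bit z) : nat).
Proof. rewrite /walsh_bad /unbalanced /ndiff /walsh /horizon; rc_tac. Qed.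

Lemma rc_tail_bad : rc2 (fun q z => tail_bad q (bit z) : nat).
Proof. rewrite /tail_bad /horizon /tail_len; rc_tac. Qed.

Lemma eq_walsh_bad q y y' : (forall p, p < prefix_len q -> y p = y' p) ->
  walsh_bad q y = walsh_bad q y'.
Proof.
move=> E.
have lt_L i : i < 2 * q -> i < tail_len q by rewrite /tail_len; lia.
apply: eq_in_has => K; rewrite mem_iota /= add0n => lt_K.
apply: eq_in_has => d; rewrite mem_iota /= add0n => lt_d.
apply: eq_in_has => S _; congr (_ && (_ && _)).
have E' n : n < K + d -> walsh psi (2 * q) S y n = walsh psi (2 * q) S y' n.
  move=> lt_n; apply: eq_walsh => i /lt_L lt_i; apply/E/psi_lt_prefix_len => //; lia.
have E2 : ndiff psi (2 * q) S y d K = ndiff psi (2 * q) S y' d K.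
  by apply: eq_big_nat => n /andP[_ lt_n]; rewrite !E' //; lia.
by rewrite /unbalanced E2.
Qed.

Lemma eq_tail_bad q y y' : (forall p, p < prefix_len q -> y p = y' p) ->
  tail_bad q y = tail_bad q y'.
Proof.
move=> E; apply: eq_in_has => n; rewrite mem_iota /= add0n => lt_n.
have -> : \sum_(0 <= i < tail_len q) y (psi n i) =
    \sum_(0 <= i < tail_len q) y' (psi n i); last by [].
apply: eq_big_nat => i /andP[_ lt_i]; rewrite E //.
apply: psi_lt_prefix_len => //; lia.
Qed.

Lemma horizon_le_prefix_len q : 2 * q + 2 * horizon q <= prefix_len q.
Proof.
rewrite /prefix_len leq_add2l -[leqLHS]mul1n mulnC -[X in X * _]subn0 -sum_nat_const_nat.
apply: leq_sum => n _; rewrite /tail_len addnS big_nat_recl //.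
Qed.

Lemma leq_exp_sub a b c : a * 2 ^ b <= 2 ^ c -> a <= 2 ^ (c - b).
Proof.
case: (leqP b c) => [le_bc|lt_cb] h.
  by rewrite -(leq_pmul2r (expn_gt0 2 b)) -expnD subnK.
case: a h => // a; rewrite mulSn => h.
have := leq_ltn_trans (leq_trans (leq_addr _ _) h) (_ : 2 ^ c < 2 ^ b).
by rewrite ltnn ltn_exp2l // => /(_ lt_cb).
Qed.

(** With the stake s = 2 ^ - (9 q), of the order of the inverse of the square root
    of K, the losses cost a constant factor, while the winnings reach
    (1 + s) ^ (2 ^ q / s) >= 2 ^ (2 ^ q). *)
Lemma betting_gain (q K C : nat) (s := ((2 ^+ (9 * q))^-1)%R : rat) :
  0 < q -> K <= horizon q -> C = 2 ^ 19 ->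
  ((2 ^+ C)^-1 * 2 ^+ (2 ^ q) <= (1 - s ^+ 2) ^+ K * (1 + s) ^+ (2 ^ (10 * q)))%R.
Proof.
move=> q0 le_K EC.
have s0 : (0 < s)%R by rewrite invr_gt0 exprn_gt0.
have sE : (s = (2 ^ (9 * q))%:R^-1)%R by rewrite natrX.
have s1 : (s <= 2^-1)%R.
  rewrite sE lef_pV2 ?posrE ?ltr0n ?expn_gt0 //.
  by rewrite ler_nat -{1}(expn1 2) leq_exp2l //; lia.
have s2 : (s ^+ 2 <= 1)%R by nra.
apply: ler_pM; rewrite ?invr_ge0 ?exprn_ge0 //.
- have le_K2 : K <= 2 ^ (18 * q - 1) * C.
    apply: leq_trans le_K _; rewrite EC -expnD leq_exp2l //; lia.
  apply: le_trans (_ : ((1 - s ^+ 2) ^+ (2 ^ (18 * q - 1) * C) <= _)%R); last first.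
    by apply: ler_wiXn2l => //; nra.
  rewrite exprM -exprVn; apply: lerXn2r; rewrite ?nnegrE ?invr_ge0 ?exprn_ge0 //; first lra.
  (* s ^ 2 is the inverse of x = 2 ^ (18 q), and (1 - 1 / x) ^ (x / 2) >= 1 / 2 *)
  have := @bernoulli_ineq rat (- s ^+ 2) (2 ^ (18 * q - 1)) _.
  have -> : ((- s ^+ 2) *+ 2 ^ (18 * q - 1) = - 2^-1)%R.
    rewrite mulNrn sE -(mulr_natr (_ ^+ 2)%R); congr (- _)%R.
    have Hx : 2 ^ (18 * q - 1) * 2 = (2 ^ (9 * q)) ^ 2.
      by rewrite -expnSr -expnM; congr expn; lia.
    apply: (@mulIf _ 2%:R) => //.
    rewrite /= -mulrA -natrM Hx (natrX _ (2 ^ (9 * q)) 2) exprVn !mulVf //.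
  move=> h; have := h ltac:(nra); lra.
- have -> : 2 ^ (10 * q) = 2 ^ (9 * q) * 2 ^ q by rewrite -expnD; congr expn; lia.
  rewrite exprM; apply: lerXn2r; rewrite ?nnegrE ?exprn_ge0 //; first lra.
  have := @bernoulli_ineq rat s (2 ^ (9 * q)) _.
  have -> : (s *+ 2 ^ (9 * q) = 1)%R.
    by rewrite -mulr_natr sE mulVf // pnatr_eq0 expn_eq0.
  move=> h; have := h ltac:(lra); lra.
Qed.

Lemma card_walsh_bad : exists q1, forall q, q1 <= q ->
  #|[set x : (prefix_len q).-tuple bool | walsh_bad q (bits x)]| <= 2 ^ (prefix_len q - 2 * q).
Proof.
(* C is made abstract so that this numeral is never computed *)
have [C EC] : exists C, C = 2 ^ 19 by exists (2 ^ 19).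
have [q1 Hq1] := expn_dominates (C + 100).
exists q1.+1 => q lt_q.
have q0 : 0 < q by lia.
have le_q : C + 1 + (18 * q.+1) + (18 * q.+1) + 2 * q + 2 * q <= 2 ^ q.
  by apply: leq_trans (Hq1 q (ltnW lt_q)); lia.
pose B := 2 ^ ((prefix_len q).+1 + C - 2 ^ q).
have step K d S : K < horizon q -> d < horizon q -> S < 2 ^ (2 * q) ->
  #|[set x : (prefix_len q).-tuple bool | [&& 0 < d, 0 < S &
     unbalanced psi (2 * q) S (bits x) d K (2 ^ (10 * q))]]| <= B.
  move=> lt_K lt_d lt_S.
  case: (posnP d) => [->|d0]; first by rewrite cardsE card0.
  case: (posnP S) => [->|S0]; first by rewrite cardsE card0.
  apply: leq_exp_sub.
  have lt_m n i : n < K + d -> i < 2 * q -> psi n i < prefix_len q.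
    move=> lt_n lt_i; apply: psi_lt_prefix_len; rewrite /tail_len; lia.
  have s0 : (0 < (2 ^+ (9 * q))^-1 :> rat)%R by rewrite invr_gt0 exprn_gt0.
  have s1 : ((2 ^+ (9 * q))^-1 < 1 :> rat)%R.
    by rewrite invf_lt1 ?exprn_gt0 // exprn_egt1 //; lia.
  have S01 : 0 < S < 2 ^ (2 * q) by rewrite S0.
  have := card_unbalanced psi_inj (2 ^ (10 * q)) lt_m S01 d0 s0 s1.
  have := betting_gain q0 (ltnW lt_K) EC.
  set w := ((1 - _) ^+ _ * _)%R => gain; set A := #|_| => card_le.
  have {}card_le : (A%:R * ((2 ^+ C)^-1 * 2 ^+ (2 ^ q)) <= (2 ^ (prefix_len q).+1)%N%:R :> rat)%R.
    by apply: le_trans card_le; apply: ler_wpM2l.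
  rewrite /= -/A; move: card_le; rewrite mulrCA mulrC ler_pdivrMr ?exprn_gt0 //.
  by rewrite -!natrX -!natrM ler_nat -expnD.
have lt : #|[set x : (prefix_len q).-tuple bool | walsh_bad q (bits x)]|
  <= horizon q * (horizon q * (2 ^ (2 * q) * B)).
  apply: card_ex_below => K lt_K; apply: card_ex_below => d lt_d; apply: card_ex_below => S lt_S.
  exact: step.
apply: leq_trans lt _; rewrite /horizon /B -!expnD leq_exp2l //.
have := horizon_le_prefix_len q.
have : 2 ^ q <= horizon q by rewrite leq_exp2l //; lia.
lia.
Qed.

Lemma card_tail_bad q :
  #|[set x : (prefix_len q).-tuple bool | tail_bad q (bits x)]| <= 2 ^ (prefix_len q - 2 * q).
Proof.
apply: leq_trans (_ : horizon q * 2 ^ ((prefix_len q).+1 - tail_len q) <= _).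
  apply: card_ex_below => n lt_n; apply: leq_exp_sub.
  apply: card_constant => // i; apply: psi_lt_prefix_len; lia.
rewrite -expnD leq_exp2l //.
have := horizon_le_prefix_len q.
have : 18 * q.+1 < horizon q by apply: ltn_expl.
rewrite /tail_len; lia.
Qed.

(** All that is used of the complexity of alpha. *)
Theorem KC_regular (U : machine) (alpha : nat -> bool) :
  universal U -> KC U alpha ->
  exists q0, forall q, q0 <= q ->
    (forall K d S, K < horizon q -> 0 < d < horizon q -> 0 < S < 2 ^ (2 * q) ->
       ~~ unbalanced psi (2 * q) S alpha d K (2 ^ (10 * q))) /\
    (forall n, n < horizon q ->
       0 < \sum_(0 <= i < tail_len q) alpha (psi n i) < tail_len q).
Proof.
move=> hU hal.
have bitE q p : p < prefix_len q -> bit (code (mkseq alpha (prefix_len q))).+1 p = alpha p.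
  by move=> lt_p; rewrite bit_code ?size_mkseq // nth_mkseq.
have le_m q : 2 * q <= prefix_len q by apply: leq_trans (horizon_le_prefix_len q); rewrite leq_addr.
have [q1 Hq1] := card_walsh_bad.
have [|q2 Hq2] := KC_test (q1 := q1) rc_prefix_len rc_walsh_bad hU hal.
  move=> q /Hq1 H; split=> //; apply: leq_trans H.
  apply: subset_leq_card; apply/fintype.subsetP => x; rewrite !inE.
  by rewrite (eq_walsh_bad (bits_code x)).
have [|q3 Hq3] := KC_test (q1 := 0) rc_prefix_len rc_tail_bad hU hal.
  move=> q _; split=> //; apply: leq_trans (card_tail_bad q).
  apply: subset_leq_card; apply/fintype.subsetP => x; rewrite !inE.
  by rewrite (eq_tail_bad (bits_code x)).
exists (maxn q2 q3) => q; rewrite geq_max => /andP[/Hq2 H2 /Hq3 H3].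
rewrite (eq_walsh_bad (bitE q)) in H2; rewrite (eq_tail_bad (bitE q)) in H3.
split.
- move=> K d S lt_K /andP[d0 lt_d] /andP[S0 lt_S]; apply: contra H2 => bad.
  apply/ex_belowP; exists K => //; apply/ex_belowP; exists d => //; apply/ex_belowP; exists S => //.
  by rewrite d0 S0.
- move=> n lt_n; rewrite lt0n ltn_neqAle andbA -negb_or; apply/andP; split.
    by apply: contra H3 => bad; apply/ex_belowP; exists n.
  rewrite -[leqRHS]mul1n mulnC -[X in _ <= X * _]subn0 -sum_nat_const_nat.
  by apply: leq_sum => i _; case: (alpha _).
Qed.

End Regular.

Local Open Scope classical_set_scope.
Local Open Scope ring_scope.

(** * Trigonometric sums of signs *)

Section Energy.
Variable R : realType.

(** This is the expansion of the squared modulus of the sum of w_n exp(i n t),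
    ordered by the differences j + 1 of the indices. *)
Lemma trig_energy (w : nat -> R) (t : R) M :
  (forall n, w n ^+ 2 = 1) ->
  (\sum_(0 <= n < M) w n * cos (n%:R * t)) ^+ 2 +
  (\sum_(0 <= n < M) w n * sin (n%:R * t)) ^+ 2 =
  M%:R + 2 * \sum_(0 <= j < M) cos (j.+1%:R * t) *
     \sum_(0 <= n < M - j.+1) w n * w (n + j.+1)%N.
Proof.
move=> w2; elim: M => [|M IH]; first by rewrite !big_geq // expr0n /= mulr0 !addr0.
set C := \sum_(0 <= n < M) _ in IH; set S := \sum_(0 <= n < M) _ in IH.
set D := \sum_(0 <= j < M) _ in IH.
rewrite [X in X ^+ 2 + _]big_nat_recr //= [X in _ + X ^+ 2]big_nat_recr //= -/C -/S.
have -> : \sum_(0 <= j < M.+1) cos (j.+1%:R * t) *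
     (\sum_(0 <= n < M.+1 - j.+1) w n * w (n + j.+1)%N) =
  D + w M * (C * cos (M%:R * t) + S * sin (M%:R * t)).
  rewrite big_nat_recr //= subnn (big_geq (leqnn 0)) mulr0 addr0.
  have -> : w M * (C * cos (M%:R * t) + S * sin (M%:R * t)) =
      \sum_(0 <= n < M) cos ((M - n)%:R * t) * (w n * w M).
    rewrite /C /S !mulr_suml -big_split /= mulr_sumr.
    apply: eq_big_nat => n /andP[_ lt_n].
    rewrite natrB ?(ltnW lt_n) // mulrBl cosB; ring.
  rewrite [in RHS]big_nat_rev /= add0n /D -big_split /=.
  apply: eq_big_nat => j /andP[_ lt_j].
  have -> : (M.+1 - j.+1 = (M - j.+1).+1)%N by lia.
  rewrite big_nat_recr //= mulrDr; congr (_ + cos (_%:R * t) * (_ * w _)); lia.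
have cs : cos (M%:R * t) ^+ 2 + sin (M%:R * t) ^+ 2 = 1 by exact: cos2Dsin2.
have := w2 M; rewrite -natr1.
move: (cos _) (sin _) (w M) cs IH => c s W cs IH W2.
have -> : (C + W * c) ^+ 2 + (S + W * s) ^+ 2 =
  (C ^+ 2 + S ^+ 2) + W ^+ 2 * (c ^+ 2 + s ^+ 2) + 2 * (W * (C * c + S * s)) by ring.
rewrite IH W2 cs; ring.
Qed.

Lemma sum_even_odd (F : nat -> R) n :
  \sum_(0 <= i < 2 * n) F i = \sum_(0 <= i < n) (F i.*2 + F i.*2.+1).
Proof.
elim: n => [|n IH]; first by rewrite !big_geq.
rewrite mulnS !big_nat_recr //= -mul2n IH -addrA; congr (_ + (F _ + F _)); lia.
Qed.

(** The sum is the product over i < L of 1 + (-1) ^ b i. *)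
Lemma walsh_complete L (b : nat -> bool) :
  \sum_(0 <= S < 2 ^ L) (-1) ^+ odd (\sum_(0 <= i < L) (bit S i && b i))%N
  = if all (fun i => ~~ b i) (iota 0 L) then 2 ^+ L else 0 :> R.
Proof.
elim: L b => [|L IH] b.
  by rewrite expn0 big_nat1 big_geq.
rewrite expnS sum_even_odd /=.
pose P S := (-1) ^+ odd (\sum_(0 <= i < L) (bit S i && b i.+1))%N : R.
have E S (c : bool) : (-1) ^+ odd (\sum_(0 <= i < L.+1) (bit (c + S.*2) i && b i))%N
    = P S * (-1) ^+ (c && b 0%N).
  rewrite big_nat_recl // bit_cons oddD oddb addbC signr_addb; congr (_ ^+ odd _ * _).
  by apply: eq_bigr => i _; rewrite bit_cons.
rewrite (eq_bigr (fun S => P S * (1 + (-1) ^+ b 0%N))); last first.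
  by move=> S _; rewrite mulrDr -(E S false) -(E S true).
rewrite -mulr_suml IH -[iota 1 L]/(iota (1 + 0) L) iotaDl all_map /=.
case: (b 0%N) => /=; first by rewrite expr1 subrr mulr0.
by rewrite expr0; case: ifP => _; rewrite ?mul0r // exprSr.
Qed.

End Energy.

Section Words.
Variables (R : realType) (psi : nat -> nat -> nat) (y : nat -> bool) (L : nat).

Definition chi S n : R := (-1) ^+ odd (walsh psi L S y n).

Lemma autocorrelation S d K :
  \sum_(0 <= n < K) chi S n * chi S (n + d)%N = K%:R - 2 * (ndiff psi L S y d K)%:R.
Proof.
elim: K => [|K IH]; first by rewrite /ndiff !big_geq // mulr0 subr0.
rewrite big_nat_recr //= IH /ndiff big_nat_recr //= -/(ndiff _ _ _ _ _ _).
rewrite /chi -signr_addb -oddD (natrD _ (ndiff psi L S y d K)) -(natr1 K).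
by case: (odd _) => /=; rewrite ?expr1 ?expr0; ring.
Qed.

Lemma autocorrelation_le S d K lam : ~~ unbalanced psi L S y d K lam ->
  `|\sum_(0 <= n < K) chi S n * chi S (n + d)%N| <= lam%:R.
Proof.
rewrite negb_or -!ltnNge => /andP[h1 h2].
have H1 : K%:R <= 2 * (ndiff psi L S y d K)%:R + lam%:R :> R.
  by rewrite -natrM -natrD ler_nat ltnW.
have H2 : 2 * (ndiff psi L S y d K)%:R <= K%:R + lam%:R :> R.
  by rewrite -natrM -natrD ler_nat ltnW.
by rewrite autocorrelation ler_norml; apply/andP; split; lra.
Qed.

Lemma chi_trig_le S H M lam (t : R) : (M < H)%N ->
  (forall K d, (K < H)%N -> (0 < d < H)%N -> ~~ unbalanced psi L S y d K lam) ->
  (\sum_(0 <= n < M) chi S n * cos (n%:R * t)) ^+ 2 +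
  (\sum_(0 <= n < M) chi S n * sin (n%:R * t)) ^+ 2 <= M%:R + 2 * (M * lam)%:R.
Proof.
move=> lt_M bal.
rewrite trig_energy; last by move=> n; rewrite /chi sqrr_sign.
rewrite lerD2l ler_wpM2l //; apply: le_trans (ler_norm _) _.
apply: le_trans (ler_norm_sum _ _ _) _.
rewrite -[M in leRHS]subn0 mulnC natrM mulr_natr -sumr_const_nat.
rewrite big_nat [leRHS]big_nat; apply: ler_sum => j /andP[_ lt_j].
rewrite normrM -[leRHS]mul1r; apply: ler_pM => //.
  by rewrite ler_norml cos_geN1 cos_le1.
by apply: autocorrelation_le; apply: bal; lia.
Qed.

(** The most significant digit comes first, so that [word n] is the integer part
    of 2 ^ L times the real number with these digits. *)
Definition word n : nat := nat_of_bits (fun i => y (psi n (L - i.+1))) L.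

Lemma word_lt n : (word n < 2 ^ L)%N.
Proof. exact: nat_of_bits_lt. Qed.

Lemma nat_of_bits_bit k : (k < 2 ^ L)%N -> nat_of_bits (bit k) L = k.
Proof.
elim: L k => [|l IH] k; first by case: k => // _; rewrite /nat_of_bits big_geq.
rewrite nat_of_bitsS => lt_k.
have E i : bit k i.+1 = bit k./2 i by rewrite /bit expnS divnMA divn2.
have -> : nat_of_bits (fun i => bit k i.+1) l = k./2.
  rewrite -[RHS]IH; last by rewrite ltn_half_double -mul2n -expnS.
  by apply: eq_bigr => i _; rewrite E.
by rewrite {1}/bit expn0 divn1 odd_double_half.
Qed.

Lemma word_indicator n k : (k < 2 ^ L)%N ->
  (word n == k)%:R = (2 ^+ L)^-1 * \sum_(0 <= S < 2 ^ L)
     (-1) ^+ odd (\sum_(0 <= i < L) (bit S i && bit k (L - i.+1)))%N * chi S n :> R.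
Proof.
move=> lt_k.
pose b i := bit k (L - i.+1) (+) y (psi n i).
have -> : (word n == k)%:R = (2 ^+ L)^-1 *
    (if all (fun i => ~~ b i) (iota 0 L) then 2 ^+ L else 0) :> R.
  have -> : (word n == k) = all (fun i => ~~ b i) (iota 0 L).
    apply/eqP/allP => [E i|hb].
      rewrite mem_iota add0n /= => lt_i; rewrite /b -E /word bit_nat_of_bits; last by lia.
      have -> : (L - (L - i.+1).+1 = i)%N by lia.
      by rewrite addbb.
    rewrite -[RHS](nat_of_bits_bit lt_k).
    apply: eq_big_nat => i /andP[_ lt_i]; congr (nat_of_bool _ * _)%N.
    have := hb (L - i.+1)%N; rewrite mem_iota add0n /= => /(_ _)/negbTE.
    rewrite /b; have -> : (L - (L - i.+1).+1 = i)%N by lia.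
    move=> h; have {h} := h ltac:(lia).
    by case: (bit k i); case: (y _).
  by case: ifP => _; rewrite ?mulr0 // mulVf // expf_neq0.
rewrite -walsh_complete; congr (_ * _); apply: eq_bigr => S _.
rewrite /chi /walsh -signr_addb; congr (_ ^+ _).
rewrite !odd_sum_addb -big_split /=. congr nat_of_bool; apply: eq_bigr => i _.
by rewrite /b; case: (bit S i).
Qed.

(** Fourier inversion: the indicator function minus its mean is an average of the
    nontrivial Walsh functions, up to signs. *)
Lemma word_discrepancy M (c : nat -> R) E k : (k < 2 ^ L)%N -> 0 <= E ->
  (forall S, (0 < S < 2 ^ L)%N -> `|\sum_(0 <= n < M) chi S n * c n| <= E) ->
  `|\sum_(0 <= n < M) ((word n == k)%:R - (2 ^+ L)^-1) * c n| <= E.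
Proof.
move=> lt_k E0 HE.
have p0 : 0 < 2 ^+ L :> R by rewrite exprn_gt0.
pose a S : R := (-1) ^+ odd (\sum_(0 <= i < L) (bit S i && bit k (L - i.+1)))%N.
have bit0 i : bit 0 i = false by rewrite /bit div0n.
have chi0 n : chi 0 n = 1.
  by rewrite /chi /walsh big1 // => i _; rewrite bit0.
have a0 : a 0%N = 1 by rewrite /a big1 // => i _; rewrite bit0.
have split0 n : (word n == k)%:R - (2 ^+ L)^-1
    = (2 ^+ L)^-1 * \sum_(1 <= S < 2 ^ L) a S * chi S n :> R.
  rewrite (word_indicator n lt_k) big_ltn ?expn_gt0 // -/(a _) a0 chi0 mulr1 mulrDr mulr1.
  by rewrite addrAC subrr add0r.
have -> : \sum_(0 <= n < M) ((word n == k)%:R - (2 ^+ L)^-1) * c n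
    = (2 ^+ L)^-1 * \sum_(1 <= S < 2 ^ L) a S * \sum_(0 <= n < M) chi S n * c n.
  rewrite (eq_bigr (fun n => (2 ^+ L)^-1 * \sum_(1 <= S < 2 ^ L) a S * (chi S n * c n))); last first.
    by move=> n _; rewrite split0 -mulrA mulr_suml; congr (_ * _); apply: eq_bigr => S _; rewrite mulrA.
  rewrite -mulr_sumr exchange_big /=; congr (_ * _).
  by apply: eq_bigr => S _; rewrite mulr_sumr.
rewrite normrM gtr0_norm ?invr_gt0 // ler_pdivrMl //.
apply: le_trans (ler_norm_sum _ _ _) _.
apply: le_trans (_ : \sum_(1 <= S < 2 ^ L) E <= _).
  rewrite big_nat [leRHS]big_nat; apply: ler_sum => S HS.
  by rewrite normrM /a normrX normrN1 expr1n mul1r HE.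
rewrite sumr_const_nat -[E *+ _]mulr_natl ler_wpM2r // -natrX ler_nat leq_subr //.
Qed.

(** The sequence x is replaced by the values of a step function h of the words.
    The mean of h vanishes, so its part is bounded with [word_discrepancy]; and
    the errors o (word n) are summed by counting how often each word occurs,
    which is [word_discrepancy] for c = 1. *)
Lemma quantized_sum_le M (x c h o : nat -> R) (E G : R) :
  0 <= E -> 0 <= G ->
  (forall S, (0 < S < 2 ^ L)%N -> `|\sum_(0 <= n < M) chi S n * c n| <= E) ->
  (forall S, (0 < S < 2 ^ L)%N -> `|\sum_(0 <= n < M) chi S n| <= E) ->
  (forall n, (n < M)%N -> `|c n| <= 1) ->
  \sum_(0 <= k < 2 ^ L) h k = 0 ->
  (forall k, (k < 2 ^ L)%N -> `|h k| <= G) ->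
  (forall k, (k < 2 ^ L)%N -> 0 <= o k) ->
  (forall n, (n < M)%N -> `|x n - h (word n)| <= o (word n)) ->
  `|\sum_(0 <= n < M) x n * c n| <=
    2 ^+ L * G * E + (\sum_(0 <= k < 2 ^ L) o k) * ((2 ^+ L)^-1 * M%:R + E).
Proof.
move=> E0 G0 Hc H1 c1 h0 hG o0 xo.
have pick (f : nat -> R) n : f (word n) = \sum_(0 <= k < 2 ^ L) f k * (word n == k)%:R.
  rewrite big_mkord (bigD1 (Ordinal (word_lt n))) //= eqxx mulr1 big1 ?addr0 // => i.
  by rewrite -val_eqE /= eq_sym => /negbTE ->; rewrite mulr0.
have -> : \sum_(0 <= n < M) x n * c n =
  \sum_(0 <= n < M) h (word n) * c n + \sum_(0 <= n < M) (x n - h (word n)) * c n.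
  by rewrite -big_split /=; apply: eq_bigr => n _; ring.
apply: le_trans (ler_normD _ _) _; apply: lerD.
- have -> : \sum_(0 <= n < M) h (word n) * c n =
    \sum_(0 <= k < 2 ^ L) h k * \sum_(0 <= n < M) ((word n == k)%:R - (2 ^+ L)^-1) * c n.
    rewrite (eq_bigr (fun n => \sum_(0 <= k < 2 ^ L) h k * (((word n == k)%:R - (2 ^+ L)^-1) * c n))); last first.
      move=> n _; rewrite (pick h) mulr_suml.
      rewrite [RHS](eq_bigr (fun k => h k * (word n == k)%:R * c n - h k * ((2 ^+ L)^-1 * c n))).
        by rewrite sumrB -mulr_suml -[X in _ - X]mulr_suml h0 mul0r subr0 mulr_suml.
      by move=> k _; ring.
    by rewrite exchange_big /=; apply: eq_bigr => k _; rewrite mulr_sumr.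
  apply: le_trans (ler_norm_sum _ _ _) _.
  apply: le_trans (_ : \sum_(0 <= k < 2 ^ L) G * E <= _).
    rewrite big_nat [leRHS]big_nat; apply: ler_sum => k /andP[_ lt_k].
    by rewrite normrM ler_pM ?hG // word_discrepancy.
  by rewrite sumr_const_nat subn0 -[_ *+ _]mulr_natl natrX mulrA.
- apply: le_trans (ler_norm_sum _ _ _) _.
  apply: le_trans (_ : \sum_(0 <= n < M) o (word n) <= _).
    rewrite big_nat [leRHS]big_nat; apply: ler_sum => n /andP[_ lt_n].
    rewrite normrM -[leRHS]mulr1; apply: ler_pM; rewrite ?c1 ?xo //.
  rewrite (eq_bigr _ (fun n _ => pick o n)) exchange_big /= mulr_suml.
  rewrite big_nat [leRHS]big_nat; apply: ler_sum => k /andP[_ lt_k].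
  rewrite -mulr_sumr ler_wpM2l ?o0 //.
  have := @word_discrepancy M (fun=> 1) E k lt_k E0.
  have hS S : (0 < S < 2 ^ L)%N -> `|\sum_(0 <= n < M) chi S n * 1| <= E.
    by move=> HS; under eq_bigr do rewrite mulr1; exact: H1.
  move=> /(_ hS)/(le_trans (ler_norm _)).
  under eq_bigr do rewrite mulr1.
  by rewrite sumrB sumr_const_nat subn0 -[_ *+ M]mulr_natr lerBlDl.
Qed.

End Words.

(** * The quantile function of the normal law *)

Section Quantile.
Variable R : realType.
Local Notation mu := (@lebesgue_measure R).
Local Notation Phi := (@normal_cdf R).
Local Notation pdf m := (@normal_pdf R m 1).

Lemma pdfE m x : pdf m x = normal_peak 1 * expR (- (x - m) ^+ 2 / 2).
Proof.
rewrite normal_pdfE ?oner_neq0 // /normal_fun expr1n.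
by congr (_ * expR (_ / _)).
Qed.

Lemma pdf_integrable m A : measurable A -> mu.-integrable A (EFin \o pdf m).
Proof.
by move=> mA; apply: integrableS (integrable_normal_pdf m 1).
Qed.

Lemma normal_cdfE x : Phi x = \int[mu]_(t in `]-oo, x]) pdf 0 t.
Proof.
rewrite /normal_cdf.
have peakE : (Num.sqrt (2 * pi))^-1 = normal_peak 1 :> R.
  by rewrite /normal_peak expr1n mul1r mulr_natl.
have peak0 : normal_peak 1 != 0 :> R by rewrite gt_eqF // normal_peak_gt0 // oner_neq0.
rewrite peakE -RintegralZl //.
  by apply: eq_Rintegral => t _; rewrite pdfE subr0.
have h := @pdf_integrable 0 `]-oo, x] (measurable_itv _).
have : mu.-integrable `]-oo, x] (fun t => ((normal_peak 1)^-1)%:E * (pdf 0 t)%:E)%E.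
  exact: integrableZl.
apply: eq_integrable => // t _ /=.
by rewrite -EFinM pdfE subr0 mulKf.
Qed.

Lemma normal_cdf_itv x y : x <= y ->
  Phi y - Phi x = \int[mu]_(t in `]x, y]) pdf 0 t.
Proof.
move=> le_xy; rewrite !normal_cdfE Rintegral_itvB //.
exact: pdf_integrable.
Qed.

Lemma Rintegral_itv_cst (x y c : R) : x <= y -> \int[mu]_(t in `]x, y]) c = c * (y - x).
Proof.
move=> le_xy; rewrite Rintegral_cst //; congr (_ * _).
rewrite /= lebesgue_measure_itv /= lte_fin; case: ltP => //= le_yx.
by apply/eqP; rewrite eq_sym subr_eq0 eq_le le_yx.
Qed.

Lemma cst_integrable (x y c : R) : mu.-integrable `]x, y] (EFin \o cst c).
Proof.
apply/integrableP; split; first exact/measurable_EFinP.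
under eq_integral do rewrite /=.
rewrite integral_cst //= lebesgue_measure_itv /=.
case: ifP => _; last by rewrite mule0 ltry.
by rewrite -EFinD -EFinM ltry.
Qed.

Lemma normal_cdf_lt x y : x < y -> Phi x < Phi y.
Proof.
move=> lt_xy; rewrite -subr_gt0 normal_cdf_itv ?ltW //.
have peak0 : 0 < normal_peak 1 :> R by rewrite normal_peak_gt0 // oner_neq0.
pose c := normal_peak 1 * expR (- (x ^+ 2 + y ^+ 2) / 2).
apply: lt_le_trans (_ : \int[mu]_(t in `]x, y]) c <= _).
  rewrite Rintegral_itv_cst ?ltW // mulr_gt0 ?subr_gt0 //.
  by rewrite mulr_gt0 ?expR_gt0.
apply: le_Rintegral => //; first exact: cst_integrable.
  exact: pdf_integrable.
move=> t /=; rewrite in_itv /= => /andP[xt ty].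
have t2 : t ^+ 2 <= x ^+ 2 + y ^+ 2 by case: (leP 0 t) => t0; nra.
by rewrite pdfE subr0 ler_pM2l // ler_expR; lra.
Qed.

Lemma normal_cdf_lipschitz x y : x <= y -> Phi y - Phi x <= normal_peak 1 * (y - x).
Proof.
move=> le_xy; rewrite normal_cdf_itv // -Rintegral_itv_cst //.
apply: le_Rintegral => //; [exact: pdf_integrable|exact: cst_integrable|].
by move=> t _; apply: normal_pdf_ub; rewrite oner_neq0.
Qed.

Lemma Rintegral_pdf m : \int[mu]_t pdf m t = 1.
Proof. by rewrite /Rintegral integral_normal_pdf. Qed.

Lemma pdf_continuous : continuous (pdf 0).
Proof. by apply: continuous_normal_pdf; rewrite oner_neq0. Qed.

Lemma normal_cdfN x : Phi (- x) = 1 - Phi x.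
Proof.
have NE : Phi (- x) = \int[mu]_(t in `]x, +oo[) pdf 0 t.
  rewrite normal_cdfE Rintegral_itv_obnd_cbnd; last exact: pdf_integrable.
  rewrite /Rintegral ge0_integration_by_substitutionNy.
  - by congr fine; apply: eq_integral => t _ /=; rewrite !pdfE !subr0 sqrrN.
  - by apply: continuous_subspaceT => t; apply: pdf_continuous.
  - by move=> t _; apply: normal_pdf_ge0.
have E1 : \int[mu]_(t in `]-oo, +oo[) pdf 0 t = 1 by rewrite set_itvNyy Rintegral_pdf.
by rewrite NE normal_cdfE -[X in X - _]E1 Rintegral_itvB //; apply: pdf_integrable.
Qed.

(** For t <= - x the density at t does not exceed its product with exp(- x - t),
    and this product is exp(1 / 2 - x) times the normal density of mean -1. *)
Lemma normal_cdf_tail x : Phi (- x) <= expR (2^-1 - x).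
Proof.
have itv_int m : mu.-integrable `]-oo, (- x)] (EFin \o pdf m) by apply: pdf_integrable.
have int2 : mu.-integrable `]-oo, (- x)] (EFin \o (fun t => expR (2^-1 - x) * pdf (-1) t)).
  have : mu.-integrable `]-oo, (- x)] (fun t => (expR (2^-1 - x))%:E * (pdf (-1) t)%:E)%E.
    by apply: integrableZl => //; exact: itv_int.
  by apply: eq_integrable => // t _ /=; rewrite EFinM.
rewrite normal_cdfE; apply: le_trans (_ : \int[mu]_(t in `]-oo, (- x)]) (expR (2^-1 - x) * pdf (-1) t) <= _).
  apply: le_Rintegral => // t /=; rewrite in_itv /= => le_t.
  rewrite !pdfE mulrCA ler_wpM2l ?normal_peak_ge0 // -expRD ler_expR; nra.
rewrite RintegralZl // -[leRHS]mulr1 ler_wpM2l ?expR_ge0 //.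
rewrite -[leRHS](Rintegral_pdf (-1)) /Rintegral; apply: fine_le.
- by apply: integrable_fin_num => //; exact: itv_int.
- by apply: integrable_fin_num => //; exact: integrable_normal_pdf.
- apply: ge0_subset_integral => //; first by apply/measurable_EFinP; exact: measurable_normal_pdf.
  by move=> t _; rewrite lee_fin normal_pdf_ge0.
Qed.

Lemma normal_cdf_continuous : continuous Phi.
Proof.
have peak0 : 0 < normal_peak 1 :> R by rewrite normal_peak_gt0 // oner_neq0.
have lip x y : `|Phi x - Phi y| <= normal_peak 1 * `|x - y|.
  wlog le_xy : x y / x <= y.
    by move=> H; case: (leP x y) => [|/ltW] /H //; rewrite distrC [in X in _ * X]distrC.
  rewrite ler0_norm; last first.
    by rewrite subr_le0; case: ltgtP le_xy => // [/normal_cdf_lt/ltW|->].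
  rewrite ler0_norm ?subr_le0 // !opprB; exact: normal_cdf_lipschitz.
move=> x; apply/cvgrPdist_le => e e0.
have d0 : 0 < (normal_peak 1)^-1 * e by apply: mulr_gt0 => //; rewrite invr_gt0.
near=> y.
apply: le_trans (lip _ _) _; rewrite -ler_pdivlMl //.
Unshelve. all: by end_near. Qed.

Lemma normal_cdf_onto a : 0 < a < 1 -> exists x, Phi x = a.
Proof.
move=> /andP[a0 a1].
have small e : 0 < e -> exists x, Phi (- x) < e /\ 0 <= x.
  move=> e0; exists (Num.max 0 (1 - ln e)); split; last by rewrite le_max lexx.
  apply: le_lt_trans (normal_cdf_tail _) _.
  rewrite -[ltRHS](lnK e0) ltr_expR.
  have : 1 - ln e <= Num.max 0 (1 - ln e) by rewrite le_max lexx orbT.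
  lra.
have [x [Hx x0]] := small _ a0.
have [|y [Hy y0]] := small (1 - a); first lra.
have le_xy : - x <= y by lra.
have Hy' : a < Phi y by move: Hy; rewrite normal_cdfN; lra.
have := @IVT _ Phi (- x) y a le_xy.
case.
- by apply: continuous_subspaceT => t; apply: normal_cdf_continuous.
- by rewrite ge_min le_max (ltW Hx) (ltW Hy') orbT.
- by move=> c _ <-; exists c.
Qed.

Lemma normal_cdf_quantile a : 0 < a < 1 -> Phi (g a) = a.
Proof. by move=> /normal_cdf_onto h; exact: (getPex h). Qed.

Lemma quantile_le a b : 0 < a -> a <= b -> b < 1 -> g a <= g b :> R.
Proof.
move=> a0 ab b1; have /normal_cdf_quantile Ha : 0 < a < 1 by rewrite a0 (le_lt_trans ab).
have /normal_cdf_quantile Hb : 0 < b < 1 by rewrite b1 (lt_le_trans a0).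
by rewrite leNgt; apply: contraL ab => /normal_cdf_lt; rewrite Ha Hb -ltNge.
Qed.

Lemma quantile_onem a : 0 < a < 1 -> g (1 - a) = - g a :> R.
Proof.
move=> a01; have /normal_cdf_quantile H1 : 0 < 1 - a < 1 by lra.
have H2 : Phi (- g a) = 1 - a by rewrite normal_cdfN normal_cdf_quantile.
apply/eqP; rewrite eq_le !leNgt; apply/andP; split; apply/negP => /normal_cdf_lt;
  by rewrite H1 H2 ltxx.
Qed.

(** The tail of the normal law is at most exponential, so that g grows at most like
    the logarithm at 0 and, by symmetry, at 1. *)
Lemma quantile_bound T a : (2 ^+ T)^-1 <= a <= 1 - (2 ^+ T)^-1 -> `|g a| <= T%:R + 1 :> R.
Proof.
have p0 : 0 < (2 ^+ T)^-1 :> R by rewrite invr_gt0 exprn_gt0.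
have low b : (2 ^+ T)^-1 <= b -> b < 1 -> - (T%:R + 1) <= g b :> R.
  move=> hb b1; have b01 : 0 < b < 1 by rewrite b1 (lt_le_trans p0).
  have := normal_cdf_tail (- g b); rewrite opprK normal_cdf_quantile // => tail.
  have : expR (- T%:R) <= expR (2^-1 + g b) :> R.
    apply: le_trans (le_trans hb tail); rewrite expRN lef_pV2 ?posrE ?expR_gt0 ?exprn_gt0 //.
    rewrite -[T%:R]mulr1 expRM_natl; apply: lerXn2r; rewrite ?nnegrE ?expR_ge0 //.
    have := expR_ge1Dx (1 : R); lra.
  rewrite ler_expR; lra.
move=> /andP[h1 h2]; have a01 : 0 < a < 1 by lra.
rewrite ler_norml low ?h1 //=; last by lra.
have := low (1 - a); rewrite quantile_onem // => h.
have := h ltac:(lra) ltac:(lra); lra.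
Qed.

End Quantile.

(** * Binary expansions and the quantization of the quantile function *)

Lemma nat_of_bits_compl (b : nat -> bool) L :
  (nat_of_bits b L + nat_of_bits (fun i => ~~ b i) L = 2 ^ L - 1)%N.
Proof.
elim: L b => [|L IH] b; first by rewrite /nat_of_bits !big_geq.
have := IH (fun i => b i.+1); rewrite !nat_of_bitsS expnS.
have : (0 < 2 ^ L)%N by rewrite expn_gt0.
case: (b 0%N) => /=; lia.
Qed.

Lemma nat_of_bits_gt0 (b : nat -> bool) L :
  (0 < \sum_(0 <= i < L) b i)%N -> (0 < nat_of_bits b L)%N.
Proof.
rewrite !lt0n; apply: contraNN; rewrite /nat_of_bits !sum_nat_seq_eq0.
by apply: sub_all => i /=; rewrite muln_eq0 expn_eq0 orbF.
Qed.

Section Binary.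
Variable R : realType.

Local Notation digits b L := (nat_of_bits (fun i => b (L - i.+1)%N) L).

Lemma binary_partial (b : nat -> bool) L :
  series (fun i => (b i)%:R / 2 ^+ i.+1 : R) L = (digits b L)%:R / 2 ^+ L.
Proof.
rewrite /series /= /nat_of_bits natr_sum mulr_suml [RHS]big_nat_rev /= add0n.
apply: eq_big_nat => i /andP[_ lt_i].
have -> : (L - (L - i.+1).+1 = i)%N by lia.
rewrite natrM natrX.
have -> : 2 ^+ L = 2 ^+ i.+1 * 2 ^+ (L - i.+1) :> R by rewrite -exprD subnKC.
by rewrite -mulf_div divff ?mulr1 // expf_neq0.
Qed.

Lemma binary_real_itv (b : nat -> bool) L :
  (digits b L)%:R / 2 ^+ L <= binary_real R b <= (digits b L).+1%:R / 2 ^+ L.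
Proof.
rewrite -(natr1 (nat_of_bits _ _)) mulrDl mul1r -binary_partial /binary_real.
set s := series _.
have mono : {homo s : n m / (n <= m)%N >-> n <= m}.
  apply/nondecreasing_seqP => n; rewrite /s seriesSr lerDl.
  by rewrite divr_ge0 ?exprn_ge0.
have bnd n m : (n <= m)%N -> s m <= s n + (2 ^+ n)^-1 - (2 ^+ m)^-1.
  elim: m => [|m IH]; first by rewrite leqn0 => /eqP ->; lra.
  rewrite leq_eqVlt => /orP[/eqP ->|]; first lra.
  rewrite ltnS => /IH {}IH; rewrite /s seriesSr -/s.
  have h : (2 ^+ m)^-1 = 2 * (2 ^+ m.+1)^-1 :> R.
    by rewrite exprS invfM mulrA mulfV ?mul1r.
  have h0 : 0 < (2 ^+ m.+1)^-1 :> R by rewrite invr_gt0 exprn_gt0.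
  have : (b m)%:R / 2 ^+ m.+1 <= (2 ^+ m.+1)^-1 :> R.
    by apply: ler_piMl; [exact: ltW | rewrite (ler_nat R _ 1) leq_b1].
  lra.
have ub n m : s m <= s n + (2 ^+ n)^-1.
  have h0 k : 0 < (2 ^+ k)^-1 :> R by rewrite invr_gt0 exprn_gt0.
  case: (leqP n m) => [/bnd|/ltnW/mono] h; first by have := h0 m; lra.
  by have := h0 n; lra.
have cv : cvgn s.
  apply: nondecreasing_is_cvgn => //.
  by exists (s 0%N + (2 ^+ 0)^-1) => _ [m _ <-].
apply/andP; split; first exact: nondecreasing_cvgn_le.
by apply: limr_le => //; near=> m; apply: ub.
Unshelve. all: by end_near. Qed.

(** Some digit is 1, so that the first T digits form a number at least 1; and some
    digit is 0. *)
Lemma binary_real_nonconstant (b : nat -> bool) T :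
  (0 < \sum_(0 <= i < T) b i < T)%N ->
  (2 ^+ T)^-1 <= binary_real R b <= 1 - (2 ^+ T)^-1.
Proof.
move=> /andP[lo hi].
have rev (c : nat -> bool) : (\sum_(0 <= i < T) c (T - i.+1) = \sum_(0 <= i < T) c i)%N.
  by rewrite [RHS]big_nat_rev.
have d1 : (0 < digits b T)%N by apply: nat_of_bits_gt0; rewrite rev.
have d2 : (0 < digits (fun i => ~~ b i) T)%N.
  apply: nat_of_bits_gt0; rewrite (rev (fun i => ~~ b i)).
  have : (\sum_(0 <= i < T) b i + \sum_(0 <= i < T) ~~ b i = T)%N.
    rewrite -big_split /= (eq_bigr (fun=> 1%N)) ?sum_nat_const_nat ?subn0 ?muln1 //.
    by move=> i _; case: (b i).
  move: hi; lia.
have compl := nat_of_bits_compl (fun i => b (T - i.+1)%N) T.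
have /andP[h1 h2] := binary_real_itv b T.
have p0 : 0 < 2 ^+ T :> R by rewrite exprn_gt0.
apply/andP; split.
- apply: le_trans h1; rewrite -[leLHS]mul1r; apply: ler_wpM2r; last by rewrite ler1n.
  by rewrite invr_ge0 ltW.
- apply: le_trans h2 _; rewrite lerBrDr -[X in _ + X]mul1r -mulrDl natr1 ler_pdivrMr // mul1r.
  rewrite -natrX ler_nat.
  have : (0 < 2 ^ T)%N by rewrite expn_gt0.
  move: compl d2; lia.
Qed.

End Binary.

Section Quantize.
Variables (R : realType) (L : nat) (L2 : (2 <= L)%N).
Let N := (2 ^ L)%N.
Let a (k : nat) : R := k%:R / 2 ^+ L.

(** The value of g at the endpoint nearest to 1/2 of the k-th dyadic interval of
    length 2 ^ - L. This choice avoids 0 and 1, which are outside the domain of g, and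
    it inherits the symmetry of g. *)
Definition quantile_step (k : nat) : R := g (a (if (k < 2 ^ L.-1)%N then k.+1 else k)).

Let N2 : (N = 2 * 2 ^ L.-1)%N.
Proof. by rewrite /N -expnS prednK // (leq_trans _ L2). Qed.
Let H2 : (2 <= 2 ^ L.-1)%N.
Proof. by rewrite -{1}(expn1 2) leq_exp2l //; lia. Qed.
Let p0 : 0 < 2 ^+ L :> R.
Proof. by rewrite exprn_gt0. Qed.

Let a_gt0 k : (0 < k)%N -> 0 < a k.
Proof. by move=> k0; rewrite divr_gt0 // ltr0n. Qed.
Let a_lt1 k : (k < N)%N -> a k < 1.
Proof. by move=> kN; rewrite ltr_pdivrMr // mul1r -natrX ltr_nat. Qed.
Let a_le k l : (k <= l)%N -> a k <= a l.
Proof. by move=> kl; apply: ler_wpM2r; rewrite ?invr_ge0 ?(ltW p0) // ler_nat. Qed.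

Let g_le k l : (0 < k)%N -> (k <= l)%N -> (l < N)%N -> g (a k) <= g (a l) :> R.
Proof. by move=> *; apply: quantile_le; rewrite ?a_gt0 ?a_lt1 ?a_le. Qed.

(** The symmetry exchanges the words k and N - 1 - k. *)
Lemma quantile_step_sum0 : \sum_(0 <= k < N) quantile_step k = 0.
Proof.
set S := LHS; suff : S = - S by move=> /eqP; rewrite -addr_eq0 -mulr2n mulrn_eq0 => /eqP.
rewrite {1}/S big_nat_rev /= add0n /S -sumrN; apply: eq_big_nat => k /andP[_ kN].
have refl m : (0 < m < N)%N -> g (a (N - m)) = - g (a m) :> R.
  move=> /andP[m0 mN]; rewrite -quantile_onem; last by rewrite a_gt0 ?a_lt1.
  suff -> : a (N - m) = 1 - a m by [].
  by rewrite /a natrB ?(ltnW mN) // mulrBl natrX divff // gt_eqF.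
rewrite /quantile_step; case: ifP => h1; case: ifP => h2.
- by move: N2 H2 h1 h2; lia.
- have -> : ((N - k.+1).+1 = N - k)%N by lia.
  by apply: refl; move: N2 H2 h1 h2; lia.
- by apply: refl; move: N2 H2 h1 h2; lia.
- by move: N2 H2 h1 h2; lia.
Qed.

Variables (T : nat) (LT : (L <= T)%N).
Let G : R := T%:R + 1.

(** At the two extreme words, the bound valid for all numbers whose first T digits
    are not constant. *)
Definition quantile_osc (k : nat) : R :=
  if (k == 0%N) || (k == N.-1) then 2 * G else g (a k.+1) - g (a k).

Let g_bound k : (0 < k < N)%N -> `|g (a k) : R| <= G.
Proof.
move=> /andP[k0 kN]; apply: quantile_bound.
have pT : (2 ^+ T)^-1 <= (2 ^+ L)^-1 :> R.
  by rewrite lef_pV2 ?posrE ?exprn_gt0 // ler_eXn2l // ltr1n.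
apply/andP; split.
  apply: le_trans pT _; rewrite -[leLHS]mul1r; apply: ler_wpM2r; last by rewrite ler1n.
  by rewrite invr_ge0 ltW.
have : a k <= 1 - (2 ^+ L)^-1; last by lra.
rewrite lerBrDr -[X in _ + X]mul1r -mulrDl natr1 ler_pdivrMr // mul1r.
by rewrite -natrX ler_nat.
Qed.

Lemma quantile_step_bound k : (k < N)%N -> `|quantile_step k| <= G.
Proof.
move=> kN; rewrite /quantile_step; apply: g_bound.
by case: ifP => [lt|/negbT]; rewrite -?leqNgt; move: N2 H2; lia.
Qed.

Let G0 : 0 <= G. Proof. by rewrite addr_ge0. Qed.

Lemma quantile_osc_ge0 k : (k < N)%N -> 0 <= quantile_osc k.
Proof.
move=> kN; rewrite /quantile_osc; case: ifP => [_|/negbT]; first by rewrite mulr_ge0.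
rewrite negb_or => /andP[k0 k1]; rewrite subr_ge0; apply: g_le; move: k0 k1 kN; lia.
Qed.

(** Between the two extreme words the oscillations of g telescope. *)
Lemma quantile_osc_sum : \sum_(0 <= k < N) quantile_osc k <= 6 * G.
Proof.
have N4 : (4 <= N)%N by move: N2 H2; lia.
have -> : N = N.-1.+1 by rewrite prednK // (leq_trans _ N4).
rewrite big_nat_recr //= big_ltn; last by move: N4; lia.
have -> : quantile_osc 0 = 2 * G by [].
have -> : quantile_osc N.-1 = 2 * G by rewrite /quantile_osc eqxx orbT.
rewrite (eq_big_nat _ _ (F2 := fun k => g (a k.+1) - g (a k))); last first.
  by move=> k h; rewrite /quantile_osc; case: ifP => // h'; move: h h' N4; lia.
rewrite telescope_sumr; last by move: N4; lia.
have := @g_bound N.-1; have := @g_bound 1%N; rewrite !ler_norml.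
move=> /(_ ltac:(move: N4; lia))/andP[h1 h2] /(_ ltac:(move: N4; lia))/andP[h3 h4].
lra.
Qed.

Lemma quantile_step_approx (k : nat) (b : R) : (k < N)%N -> a k <= b <= a k.+1 ->
  `|g b : R| <= G -> `|g b - quantile_step k| <= quantile_osc k.
Proof.
move=> kN /andP[h1 h2] gb; rewrite /quantile_osc; case: ifP => [_|/negbT].
  apply: le_trans (ler_normB _ _) _; have := quantile_step_bound kN; lra.
rewrite negb_or => /andP[k0 k1].
have k0' : (0 < k)%N by lia.
have kN' : (k.+1 < N)%N by move: k1 kN; lia.
have le1 : g (a k) <= g b :> R.
  by apply: quantile_le; rewrite ?a_gt0 // (le_lt_trans h2) ?a_lt1.
have le2 : g b <= g (a k.+1) :> R.
  by apply: quantile_le; rewrite ?a_lt1 // (lt_le_trans _ h1) ?a_gt0.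
by rewrite /quantile_step ler_norml; case: ifP => _; apply/andP; split; lra.
Qed.

End Quantize.

(** * Trigonometric sums with coefficients g(beta_n) *)

Section TrigSum.
Variables (R : realType) (psi : nat -> nat -> nat) (U : machine) (alpha : nat -> bool).
Hypothesis psi_inj : forall n i n' i', psi n i = psi n' i' -> n = n' /\ i = i'.
Hypothesis psi_rc : rc2 psi.
Hypothesis hU : universal U.
Hypothesis halpha : KC U alpha.

Let x n : R := g (binary_real R (fun i => alpha (psi n i))).

(** The square root of N + 2 N 2 ^ (10 q), where N = 2 ^ (18 (q + 1)), is at most
    2 ^ (10 + 14 q). *)
Lemma chi_sum_le q M S (t : R) : (M < horizon q)%N ->
  (forall K d, (K < horizon q)%N -> (0 < d < horizon q)%N ->
     ~~ unbalanced psi (2 * q) S alpha d K (2 ^ (10 * q))) ->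
  `|\sum_(0 <= n < M) chi R psi alpha (2 * q) S n * cos (n%:R * t)| <= 2 ^+ (10 + 14 * q) /\
  `|\sum_(0 <= n < M) chi R psi alpha (2 * q) S n * sin (n%:R * t)| <= 2 ^+ (10 + 14 * q).
Proof.
move=> lt_M bal; have := @chi_trig_le R psi alpha (2 * q) S _ M _ t lt_M bal.
have le_E : M%:R + 2 * (M * 2 ^ (10 * q))%:R <= (2 ^+ (10 + 14 * q)) ^+ 2 :> R.
  rewrite -!natrX -natrM -natrD ler_nat -expnM.
  have -> : ((10 + 14 * q) * 2 = 2 + (18 * q.+1 + 10 * q))%N by lia.
  rewrite expnD expnD -/(horizon q).
  have : (0 < 2 ^ (10 * q))%N by rewrite expn_gt0.
  move: lt_M; nia.
have E0 : 0 <= 2 ^+ (10 + 14 * q) :> R by rewrite exprn_ge0.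
have root (z : R) : z ^+ 2 <= (2 ^+ (10 + 14 * q)) ^+ 2 -> `|z| <= 2 ^+ (10 + 14 * q).
  by rewrite -[z ^+ 2]real_normK ?num_real // ler_pXn2r ?nnegrE.
move=> h; split; apply: root; apply: le_trans le_E; apply: le_trans h.
- by rewrite lerDl sqr_ge0.
- by rewrite lerDr sqr_ge0.
Qed.

(** For M between 2 ^ (18 q) and the horizon, [quantized_sum_le] applies with words
    of length 2 q. Both of its terms are at most M 4 ^ - q up to constants and
    the bound 20 q + 21 on |x n|, which is absorbed by a factor 2 ^ q. *)
Lemma KC_trig_sum : exists C : R, exists q0, 0 <= C /\ forall q M (t : R),
  (q0 <= q)%N -> (2 ^ (18 * q) <= M)%N ->
  `|\sum_(0 <= n < M) x n * cos (n%:R * t)| <= C * M%:R / 2 ^+ q /\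
  `|\sum_(0 <= n < M) x n * sin (n%:R * t)| <= C * M%:R / 2 ^+ q.
Proof.
have [q0 Hq0] := KC_regular psi_inj psi_rc hU halpha.
pose C : R := 2 ^+ 13 * 41; have C0 : 0 <= C by rewrite mulr_ge0 ?exprn_ge0.
suff block q M (c : nat -> R) : (q0 < q)%N -> (2 ^ (18 * q) <= M < horizon q)%N ->
    (forall n, (n < M)%N -> `|c n| <= 1) ->
    (forall S, (0 < S < 2 ^ (2 * q))%N ->
       `|\sum_(0 <= n < M) chi R psi alpha (2 * q) S n * c n| <= 2 ^+ (10 + 14 * q)) ->
    `|\sum_(0 <= n < M) x n * c n| <= C * M%:R / 2 ^+ q.
  exists C, q0.+1; split=> // q M t le_q le_M.
  have M0 : (0 < M)%N by apply: leq_trans le_M; rewrite expn_gt0.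
  (* M may be far beyond the q-th block; it lies in some later one *)
  pose r := trunc_log (2 ^ 18) M.
  have P18 : (1 < 2 ^ 18)%N by rewrite -{1}(expn0 2) ltn_exp2l.
  have /andP[lo hi] := trunc_log_bounds P18 M0.
  have le_qr : (q <= r)%N by apply: trunc_log_max => //; rewrite -expnM.
  have hM : (2 ^ (18 * r) <= M < horizon r)%N by rewrite /horizon !expnM lo hi.
  have lt_r : (q0 < r)%N by apply: leq_trans le_qr.
  have [Hr _] := Hq0 r (ltnW lt_r).
  have mono : C * M%:R / 2 ^+ r <= C * M%:R / 2 ^+ q.
    rewrite ler_wpM2l ?mulr_ge0 // lef_pV2 ?posrE ?exprn_gt0 //.
    by rewrite ler_eXn2l // ltr1n.
  have /andP[_ hM2] := hM.
  split; apply: le_trans mono; apply: block => //.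
  - by move=> n _; rewrite ler_norml cos_geN1 cos_le1.
  - by move=> S HS; have [] := @chi_sum_le r M S t hM2 (fun K d hK hd => Hr K d S hK hd HS).
  - by move=> n _; rewrite ler_norml sin_geN1 sin_le1.
  - by move=> S HS; have [] := @chi_sum_le r M S t hM2 (fun K d hK hd => Hr K d S hK hd HS).
move=> lt_q /andP[lo hi] c1 Hc.
have [Hr Ht] := Hq0 q (ltnW lt_q).
have q1 : (0 < q)%N by apply: leq_trans lt_q.
have L2 : (2 <= 2 * q)%N by lia.
have LT : (2 * q <= tail_len q)%N by rewrite /tail_len; lia.
set L := (2 * q)%N in L2 LT Hc Hr *; set T := tail_len q in LT Ht.
set E : R := 2 ^+ (10 + 14 * q) in Hc.
pose G : R := T%:R + 1.
have E0 : 0 <= E by rewrite exprn_ge0.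
have G0 : 0 <= G by rewrite addr_ge0.
have xG n : (n < M)%N -> `|x n| <= G.
  move=> lt_n; apply: quantile_bound; apply: binary_real_nonconstant.
  by apply: Ht; apply: ltn_trans hi.
have H1 S : (0 < S < 2 ^ L)%N -> `|\sum_(0 <= n < M) chi R psi alpha L S n| <= E.
  move=> HS; have [+ _] := @chi_sum_le q M S 0 hi (fun K d hK hd => Hr K d S hK hd HS).
  by under eq_bigr do rewrite mulr0 cos0 mulr1.
have approx n : (n < M)%N -> `|x n - quantile_step R L (word psi alpha L n)| <= quantile_osc R L T (word psi alpha L n).
  move=> lt_n; apply: quantile_step_approx => //; [exact: word_lt | | exact: xG].
  exact: binary_real_itv.
have main := quantized_sum_le E0 G0 Hc H1 c1 (quantile_step_sum0 R L2) (quantile_step_bound R L2 LT) (quantile_osc_ge0 R L2 LT) approx.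
apply: le_trans main _.
have osum := quantile_osc_sum R L2 LT; rewrite -/G in osum.
have B0 : 0 <= (2 ^+ L)^-1 * M%:R + E :> R by apply: addr_ge0 => //; apply: mulr_ge0 => //; rewrite invr_ge0 exprn_ge0.
apply: le_trans (_ : 2 ^+ L * G * E + 6 * G * ((2 ^+ L)^-1 * M%:R + E) <= _).
  by rewrite lerD2l; apply: ler_wpM2r.
set w : R := (2 ^+ q)^-1.
have w0 : 0 < w by rewrite invr_gt0 exprn_gt0.
have LE : (2 ^+ L)^-1 = w ^+ 2 :> R by rewrite /L mulnC exprM /w exprVn.
have EM : 2 ^+ L * E <= 2 ^+ 10 * w ^+ 2 * M%:R.
  rewrite /E -exprD.
  have -> : (L + (10 + 14 * q) = 10 + 16 * q)%N by rewrite /L; lia.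
  rewrite exprD -mulrA ler_wpM2l ?exprn_ge0 // -LE ler_pdivlMl ?exprn_gt0 //.
  by rewrite -exprD -natrX ler_nat; apply: leq_trans lo; rewrite leq_exp2l // /L; lia.
have E_le : E <= 2 ^+ 10 * w ^+ 2 * M%:R.
  apply: le_trans EM; rewrite -[leLHS]mul1r ler_wpM2r //.
  by rewrite -natrX ler1n expn_gt0.
have Gq : G * w <= 41.
  rewrite ler_pdivrMr ?exprn_gt0 // /G natr1 -natrX -natrM ler_nat /T /tail_len.
  have : (q < 2 ^ q)%N by apply: ltn_expl.
  by move: q1; lia.
have M0 : 0 <= M%:R :> R by [].
rewrite LE; set m : R := M%:R in EM E_le M0 *.
have -> : 2 ^+ L * G * E = G * (2 ^+ L * E) by ring.
apply: le_trans (_ : G * (2 ^+ 10 * w ^+ 2 * m) + 6 * G * (w ^+ 2 * m + 2 ^+ 10 * w ^+ 2 * m) <= _).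
  apply: lerD; first exact: ler_wpM2l.
  by apply: ler_wpM2l; [rewrite mulr_ge0 | rewrite lerD2l].
have -> : G * (2 ^+ 10 * w ^+ 2 * m) + 6 * G * (w ^+ 2 * m + 2 ^+ 10 * w ^+ 2 * m)
  = (7 * 2 ^+ 10 + 6) * (G * w) * (w * m) by ring.
have -> : C * m * w = (2 ^+ 13 * 41) * (w * m) by rewrite /C; ring.
apply: ler_wpM2r; first by apply: mulr_ge0 => //; apply: ltW.
apply: ler_pM => //.
  by apply: mulr_ge0 => //; apply: ltW.
have -> : 2 ^+ 13 = 2 ^+ 3 * 2 ^+ 10 :> R by rewrite -exprD.
have : 6 <= 2 ^+ 10 :> R by rewrite -natrX ler_nat.
by move: (2 ^+ 10) => z; rewrite !exprS expr0; lra.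
Qed.

End TrigSum.

(** * Convergence from bounds on trigonometric sums *)

Section Convergence.
Variable R : realType.

Lemma abel_summation (a : nat -> R) A B : (0 < A <= B)%N ->
  \sum_(A <= n < B) a n / n%:R =
  (\sum_(0 <= k < B) a k) / B%:R - (\sum_(0 <= k < A) a k) / A%:R +
  \sum_(A <= n < B) (\sum_(0 <= k < n.+1) a k) / (n%:R * n.+1%:R).
Proof.
move=> /andP[A0 le_AB].
pose T n := \sum_(0 <= k < n) a k.
rewrite -(telescope_sumr (fun n => T n / n%:R) le_AB) -big_split /=.
apply: eq_big_nat => n /andP[le_An _].
have n0 : n%:R != 0 :> R by rewrite pnatr_eq0 -lt0n (leq_trans A0).
have n1 : n%:R + 1 != 0 :> R by rewrite natr1 pnatr_eq0.
rewrite -/(T n.+1) /T big_nat_recr //= -natr1; field.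
by rewrite n0 n1.
Qed.

(** In the q-th block, where n is between 2 ^ (18 q) and 2 ^ (18 (q + 1)), the sum of
    the 1 / n is bounded, so that summation by parts costs a constant factor and
    the bounds C 2 ^ - q of the successive blocks form a geometric series. *)
Lemma dyadic_abel (a : nat -> R) (C : R) q0 : 0 <= C ->
  (forall q M, (q0 <= q)%N -> (2 ^ (18 * q) <= M)%N ->
     `|\sum_(0 <= n < M) a n| <= C * M%:R / 2 ^+ q) ->
  forall q A B, (q0 <= q)%N -> (2 ^ (18 * q) <= A)%N -> (A <= B)%N ->
  `|\sum_(A <= n < B) a n / n%:R| <= C * (2 + 2 ^+ 19) / 2 ^+ q.
Proof.
move=> C0 H q A B le_q le_A le_AB.
have pos r : (0 < 2 ^ (18 * r))%N by rewrite expn_gt0.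
have A0 : (0 < A)%N by apply: leq_trans le_A.
have B0 : (0 < B)%N by apply: leq_trans le_AB.
rewrite abel_summation ?A0 //.
pose f n : R := `|\sum_(0 <= k < n.+1) a k| / (n%:R * n.+1%:R).
have f0 n : 0 <= f n by rewrite /f divr_ge0 // mulr_ge0.
have f_le r n : (q0 <= r)%N -> (2 ^ (18 * r) <= n)%N -> f n <= C / 2 ^+ r / 2 ^+ (18 * r).
  move=> le_r le_n; have n0 : 0 < n%:R :> R by rewrite ltr0n (leq_trans (pos r)).
  rewrite /f ler_pdivrMr ?mulr_gt0 //.
  apply: le_trans (H r n.+1 le_r (leqW le_n)) _.
  have -> : C * n.+1%:R / 2 ^+ r = (C / 2 ^+ r * n.+1%:R) * 1 by ring.
  have -> : C / 2 ^+ r / 2 ^+ (18 * r) * (n%:R * n.+1%:R) =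
    (C / 2 ^+ r * n.+1%:R) * (n%:R / 2 ^+ (18 * r)) by ring.
  apply: ler_wpM2l; first by rewrite mulr_ge0 // mulr_ge0 // invr_ge0 exprn_ge0.
  by rewrite ler_pdivlMr ?exprn_gt0 // mul1r -natrX ler_nat.
have block Q : (q <= Q)%N -> \sum_(2 ^ (18 * q) <= n < 2 ^ (18 * Q)) f n <=
    C * 2 ^+ 19 * ((2 ^+ q)^-1 - (2 ^+ Q)^-1).
  elim: Q => [|Q IH]; first by rewrite leqn0 => /eqP ->; rewrite big_geq // subrr mulr0.
  rewrite leq_eqVlt => /orP[/eqP <-|]; first by rewrite big_geq // subrr mulr0.
  rewrite ltnS => le_qQ; have {}IH := IH le_qQ.
  rewrite (@big_cat_nat _ _ _ (2 ^ (18 * Q))) /=; [ | by rewrite leq_exp2l //; lia | by rewrite leq_exp2l //; lia].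
  have -> : (2 ^+ q)^-1 - (2 ^+ Q.+1)^-1 = ((2 ^+ q)^-1 - (2 ^+ Q)^-1) + (2 ^+ Q)^-1 / 2 :> R.
    by rewrite exprS invfM; lra.
  rewrite mulrDr; apply: lerD => //.
  apply: le_trans (_ : \sum_(2 ^ (18 * Q) <= n < 2 ^ (18 * Q.+1)) C / 2 ^+ Q / 2 ^+ (18 * Q) <= _).
    rewrite big_nat [leRHS]big_nat; apply: ler_sum => n /andP[le_n _].
    by apply: f_le => //; apply: leq_trans le_qQ.
  rewrite sumr_const_nat -[_ *+ _]mulr_natl.
  apply: le_trans (_ : (2 ^ (18 * Q.+1))%:R * (C / 2 ^+ Q / 2 ^+ (18 * Q)) <= _).
    rewrite ler_wpM2r ?ler_nat ?leq_subr //.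
    by rewrite mulr_ge0 ?invr_ge0 ?exprn_ge0 // mulr_ge0 ?invr_ge0 ?exprn_ge0.
  rewrite mulnS expnD natrM !natrX.
  have x0 : 2 ^+ (18 * Q) != 0 :> R by rewrite expf_neq0.
  have -> : 2 ^+ 18 * 2 ^+ (18 * Q) * (C / 2 ^+ Q / 2 ^+ (18 * Q)) = C * 2 ^+ 18 / 2 ^+ Q :> R.
    by field; rewrite x0 expf_neq0.
  have -> : 2 ^+ 19 = 2 * 2 ^+ 18 :> R by rewrite -exprS.
  have -> : C * (2 * 2 ^+ 18) * ((2 ^+ Q)^-1 / 2) = C * 2 ^+ 18 / 2 ^+ Q :> R.
    by field; rewrite expf_neq0.
  by [].
have TM M : (A <= M)%N -> `|(\sum_(0 <= k < M) a k) / M%:R| <= C / 2 ^+ q.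
  move=> le_AM; have M0 : 0 < M%:R :> R by rewrite ltr0n (leq_trans A0).
  rewrite normrM normfV (ger0_norm (ltW M0)) ler_pdivrMr //.
  by rewrite mulrAC; apply: H => //; apply: leq_trans le_AM.
have main : `|\sum_(A <= n < B) (\sum_(0 <= k < n.+1) a k) / (n%:R * n.+1%:R)| <= C * 2 ^+ 19 / 2 ^+ q.
  apply: le_trans (ler_norm_sum _ _ _) _.
  rewrite (eq_bigr f); last first.
    by move=> n _; rewrite normrM normfV; congr (_ / _); rewrite ger0_norm // mulr_ge0.
  have le_qB : (q <= B)%N.
    apply: leq_trans le_AB; apply: leq_trans le_A; apply: leq_trans (ltnW (ltn_expl _ (isT : 1 < 2)%N)) _.
    by rewrite leq_exp2l //; lia.
  have le_BB : (B <= 2 ^ (18 * B))%N.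
    apply: leq_trans (ltnW (ltn_expl _ (isT : 1 < 2)%N)) _.
    by rewrite leq_exp2l //; lia.
  apply: le_trans (le_trans (block B le_qB) _); last first.
    apply: ler_wpM2l; first by rewrite mulr_ge0 ?exprn_ge0.
    by rewrite gerBl invr_ge0 exprn_ge0.
  rewrite [leRHS](@big_cat_nat _ _ _ A) ?(leq_trans le_AB) //=.
  rewrite [X in _ <= _ + X](@big_cat_nat _ _ _ B) //=.
  by rewrite addrCA lerDl addr_ge0 // sumr_ge0.
have h1 := TM B le_AB; have h2 := TM A (leqnn A).
apply: le_trans (ler_normD _ _) _.
have h3 := ler_normB ((\sum_(0 <= k < B) a k) / B%:R) ((\sum_(0 <= k < A) a k) / A%:R).
have -> : C * (2 + 2 ^+ 19) / 2 ^+ q = C / 2 ^+ q + C / 2 ^+ q + C * 2 ^+ 19 / 2 ^+ q by ring.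
by apply: lerD main; apply: le_trans h3 _; apply: lerD.
Qed.

Lemma uniform_cauchy_limit (F : nat -> R -> R) :
  (forall n, continuous (F n)) ->
  (forall e, 0 < e -> exists N, forall n t, (N <= n)%N -> `|F n t - F N t| <= e) ->
  exists W : R -> R, continuous W /\ forall t, F n t @[n --> \oo] --> W t.
Proof.
move=> Fc Hc.
have cv t : cvgn (F ^~ t).
  apply: cauchy_cvg; apply: cauchy_exP => e e0.
  have [N HN] := Hc (e / 2) ltac:(lra).
  exists (F N t); exists N => // n /= le_n.
  rewrite /ball /= distrC; apply: le_lt_trans (HN n t le_n) _; lra.
pose W t := limn (F ^~ t).
have Wl t : F n t @[n --> \oo] --> W t by exact: cv.
exists W; split=> // t.
apply/cvgrPdist_le => e e0.
have [N HN] := Hc (e / 3) ltac:(lra).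
have near_W s : `|W s - F N s| <= e / 3.
  have : (fun n => `|F n s - F N s|) @ \oo --> `|W s - F N s|.
    by apply: cvg_norm; apply: cvgB => //; apply: cvg_cst.
  move=> h; rewrite -(cvg_lim _ h) //; apply: limr_le; first exact: cvgP h.
  by exists N => // n /= le_n; exact: HN.
near=> s.
have -> : W t - W s = (W t - F N t) + (F N t - F N s) - (W s - F N s) by ring.
have : `|F N t - F N s| <= e / 3.
  by near: s; apply: cvgr_dist_le; [exact: Fc | lra].
have := near_W t; have := near_W s; rewrite !ler_norml.
move=> /andP[? ?] /andP[? ?] /andP[? ?]; apply/andP; split; lra.
Unshelve. all: by end_near. Qed.

End Convergence.

(** * The Fourier-Wiener series *)

Section FourierWiener.
Variables (R : realType) (phi : nat -> nat -> nat) (alpha : nat -> bool).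
Local Notation F := (@fourier_wiener R phi alpha).
Local Notation Xc := (@X R phi alpha).
Local Notation Yc := (@Y R phi alpha).

(** The constant part of 1 - cos is written as a cosine at t = 0, so that the three
    sums are all of the same kind. *)
Lemma fourier_wienerB N M t : (N <= M)%N ->
  F M t - F N t = Num.sqrt 2 * (2 * pi)^-1 *
   (\sum_(N.+1 <= n < M.+1) Xc n * sin (n%:R * (2 * pi * t)) / n%:R +
    \sum_(N.+1 <= n < M.+1) Yc n * cos (n%:R * 0) / n%:R -
    \sum_(N.+1 <= n < M.+1) Yc n * cos (n%:R * (2 * pi * t)) / n%:R).
Proof.
move=> le_NM; have -> : F M t = F N t + Num.sqrt 2 * \sum_(N.+1 <= n < M.+1) (2 * pi * n%:R)^-1 *
    (Xc n * sin (2 * pi * n%:R * t) + Yc n * (1 - cos (2 * pi * n%:R * t))).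
  by rewrite /fourier_wiener (@big_cat_nat _ _ _ N.+1) //= mulrDr addrA.
rewrite addrAC subrr add0r.
rewrite -mulrA; congr (_ * _); rewrite -sumrN -!big_split /= mulr_sumr.
apply: eq_big_nat => n /andP[lt_n _].
have n0 : n%:R != 0 :> R by rewrite pnatr_eq0 -lt0n (leq_trans _ lt_n).
have pi0 : pi != 0 :> R by rewrite gt_eqF // pi_gt0.
have -> : 2 * pi * n%:R * t = n%:R * (2 * pi * t) :> R by ring.
rewrite mulr0 cos0; move: (sin _) (cos _) => s c.
move: (pi : R) pi0 => p p0; field.
by rewrite n0 p0.
Qed.

Lemma fourier_wiener_continuous N : continuous (F N).
Proof.
elim: N => [|N IH].
  have -> : F 0%N = fun t => Xc 0 * t.
    by apply/funext => t; rewrite /fourier_wiener big_geq // mulr0 addr0.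
  by move=> t; apply: cvgM; [exact: cvg_cst|exact: cvg_id].
have -> : F N.+1 = fun t => F N t + Num.sqrt 2 * ((2 * pi * N.+1%:R)^-1 *
    (Xc N.+1 * sin (2 * pi * N.+1%:R * t) + Yc N.+1 * (1 - cos (2 * pi * N.+1%:R * t)))).
  by apply/funext => t; rewrite /fourier_wiener big_nat_recr //= mulrDr addrA.
have lin t : (fun s => 2 * pi * N.+1%:R * s : R) @ t --> (2 * pi * N.+1%:R * t : R).
  by apply: cvgM; [exact: cvg_cst|exact: cvg_id].
move=> t; apply: cvgD; first exact: IH.
apply: cvgM; first exact: cvg_cst.
apply: cvgM; first exact: cvg_cst.
apply: cvgD; apply: cvgM; try exact: cvg_cst.
  by apply: continuous_cvg; [exact: continuous_sin|exact: lin].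
apply: cvgB; first exact: cvg_cst.
by apply: continuous_cvg; [exact: continuous_cos|exact: lin].
Qed.

End FourierWiener.

Theorem theorem5p4 (R : realType) (U : machine) (hU : universal U)
    (phi : nat -> nat -> nat) (phi_comp : computable2 phi)
    (phi_bij : bijective (fun p : nat * nat => phi p.1 p.2))
    (alpha : nat -> bool) (halpha : KC U alpha) :
  exists W : R -> R,
    {within `[0, 1], continuous W} /\
    forall t : R, 0 <= t <= 1 ->
      (fun N : nat => fourier_wiener phi alpha N t) @ \oo --> W t.
Proof.
have phi_rc : rc2 phi := computable2_rc phi_comp.
have phi_inj n i n' i' : phi n i = phi n' i' -> n = n' /\ i = i'.
  by move=> E; have := bij_inj phi_bij (x1 := (n, i)) (x2 := (n', i')) E => -[-> ->].
(* even and odd indices give X and Y: twice the same lemma, for two sets of positions *)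
have [CX [qX [CX0 HX]]] := @KC_trig_sum R (fun n i => phi n.*2 i) U alpha
  ltac:(by move=> n i n' i' /phi_inj[/double_inj -> ->])
  ltac:(under eq_fun do rewrite -muln2; rc_tac) hU halpha.
have [CY [qY [CY0 HY]]] := @KC_trig_sum R (fun n i => phi n.*2.+1 i) U alpha
  ltac:(by move=> n i n' i' /phi_inj[[/double_inj -> ->]])
  ltac:(under eq_fun do rewrite -muln2; rc_tac) hU halpha.
have HX' t := dyadic_abel (a := fun n => X R phi alpha n * sin (n%:R * t)) CX0
  (fun q M hq hM => (HX q M t hq hM).2).
have HY' t := dyadic_abel (a := fun n => Y R phi alpha n * cos (n%:R * t)) CY0
  (fun q M hq hM => (HY q M t hq hM).1).
pose D : R := Num.sqrt 2 * (2 * pi)^-1 * ((CX + CY + CY) * (2 + 2 ^+ 19)).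
have P0 : 0 <= Num.sqrt 2 * (2 * pi)^-1 :> R.
  by rewrite mulr_ge0 ?sqrtr_ge0 // invr_ge0 mulr_ge0 // pi_ge0.
have D0 : 0 <= D.
  by rewrite /D mulr_ge0 // mulr_ge0 ?addr_ge0 ?exprn_ge0.
have cauchy q n t : (maxn qX qY <= q)%N -> (2 ^ (18 * q) <= n)%N ->
    `|fourier_wiener phi alpha n t - fourier_wiener phi alpha (2 ^ (18 * q)) t : R| <= D / 2 ^+ q.
  rewrite geq_max => /andP[leX leY] le_n.
  rewrite fourier_wienerB // normrM (ger0_norm P0) /D -[leRHS]mulrA.
  apply: ler_wpM2l => //.
  have lS : (2 ^ (18 * q) <= (2 ^ (18 * q)).+1)%N by [].
  have h1 := HX' (2 * pi * t) q _ n.+1 leX lS le_n.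
  have h2 := HY' 0 q _ n.+1 leY lS le_n.
  have h3 := HY' (2 * pi * t) q _ n.+1 leY lS le_n.
  apply: le_trans (ler_normB _ _) _.
  have -> : (CX + CY + CY) * (2 + 2 ^+ 19) / 2 ^+ q =
    (CX * (2 + 2 ^+ 19) / 2 ^+ q + CY * (2 + 2 ^+ 19) / 2 ^+ q) + CY * (2 + 2 ^+ 19) / 2 ^+ q by ring.
  apply: lerD h3; exact: le_trans (ler_normD _ _) (lerD h1 h2).
have [W [Wc Wl]] : exists W : R -> R, continuous W /\
    forall t, fourier_wiener phi alpha N t @[N --> \oo] --> W t.
  apply: uniform_cauchy_limit; first exact: fourier_wiener_continuous.
  move=> e e0.
  pose q := maxn (maxn qX qY) (Num.truncn (D / e)).+1.
  exists (2 ^ (18 * q))%N => n t le_n.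
  apply: le_trans (cauchy q n t (leq_maxl _ _) le_n) _.
  rewrite ler_pdivrMr ?exprn_gt0 // mulrC -ler_pdivrMr //.
  apply: le_trans (ltW (truncnS_gt _)) _.
  rewrite -natrX ler_nat; apply: leq_trans (ltnW (ltn_expl _ (isT : 1 < 2)%N)) _.
  by rewrite leq_exp2l // leq_maxr.
exists W; split; first exact: continuous_subspaceT.
by move=> t _; apply: Wl.
Qed.
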